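(* Let $k$ be an algebraically closed field of characteristic $p>0$ and let $(\mathfrak{g},[p])$ be a finite-dimensional restricted Lie algebra over $k$ whose nullcone $V(\mathfrak{g})=\{x\in\mathfrak{g} : x^{[p]}=0\}$ is a linear subspace of $\mathfrak{g}$. Let $j\in\{1,\ldots,p-1\}$ and let $M$ be a finite-dimensional $U_0(\mathfrak{g})$-module of constant $j$-rank, with dual module $M^\ast$. Then \[ \deg^j(M)+\deg^j(M^\ast)=j\,\mathrm{rk}^j(M).\]
   Context: $U_0(\mathfrak{g})=U(\mathfrak{g})/(\{x^p-x^{[p]} : x\in\mathfrak{g}\})$ is the restricted enveloping algebra; the dual $M^\ast$ carries the action $(x.f)(m)=-f(x.m)$ for $x\in\mathfrak{g}$. For a module $M$ and $x\in\mathfrak{g}$, $x_M:M\to M$ is the operator $m\mapsto x.m$. The generic $j$-rank is $\mathrm{rk}^j(M)=\max\{\mathrm{rk}(x_M^j) : x\in V(\mathfrak{g})\}$, and $M$ has constant $j$-rank if $\mathrm{rk}(x_M^j)=\mathrm{rk}(y_M^j)$ for all $x,y\in V(\mathfrak{g})\setminus\{0\}$. Degree of a morphism: if $U\subseteq\mathbb{P}^n$ is non-empty open and $\varphi:U\to\mathbb{P}^m$ is a morphism, there are homogeneous polynomials $f_0,\ldots,f_m\in k[X_0,\ldots,X_n]$ of the same degree $d$ with $\gcd(f_0,\ldots,f_m)=1$ and $\varphi(x)=(f_0(x):\cdots:f_m(x))$ for all $x\in U$; they are unique up to a common non-zero scalar, and $\deg(\varphi):=d$. Degree of a module: suppose $V(\mathfrak{g})$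 is a subspace of $\mathfrak{g}$ and let $d_j=\mathrm{rk}^j(M)$. The set $U_{M,j}=\{[x]\in\mathbb{P}(V(\mathfrak{g})) : \mathrm{rk}(x_M^j)=d_j\}$ is open, and $\mathrm{im}^j_M:U_{M,j}\to\mathrm{Gr}_{d_j}(M)$, $[x]\mapsto\mathrm{im}\,x_M^j$, is a morphism to the Grassmannian of $d_j$-dimensional subspaces of $M$. Let $\mathrm{pl}_M:\mathrm{Gr}_{d_j}(M)\to\mathbb{P}(\bigwedge^{d_j}M)$ be the Plücker embedding. The $j$-degree is $\deg^j(M):=\deg(\mathrm{pl}_M\circ\mathrm{im}^j_M)$ if $d_j>0$, and $\deg^j(M):=0$ if $d_j=0$.
   Formalization: The formal theorem adds the assumption that V(g) is not one-dimensional: if dim V(g) = 1, then P(V(g)) is a point, both degrees are 0, and the stated formula fails whenever rk^j(M) > 0. *)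

(* Defs.v *)
From HB Require Import structures.
From mathcomp Require Import all_boot all_order all_algebra.
From mathcomp Require Import boolp.
From mathcomp Require Import finmap mpoly.
From mathcomp Require xfinmap monalg.

Set Implicit Arguments.
Unset Strict Implicit.
Unset Printing Implicit Defensive.

Import GRing.Theory.
Local Open Scope ring_scope.
Local Open Scope quotient_scope.

Section TwoSidedQuotient.
Variables (A : pzRingType) (S : A -> Prop).

Inductive gen_ideal : A -> Prop :=
| gen_ideal0 : gen_ideal 0
| gen_idealD a s b x : S s -> gen_ideal x -> gen_ideal (a * s * b + x).

Definition two_sided_ideal (x : A) : bool := `[< gen_ideal x >].

Lemma gen_ideal_add x y : gen_ideal x -> gen_ideal y -> gen_ideal (x + y).
Proof.
move=> + Iy; elim=> [|a s b z Ss _ IH]; first by rewrite add0r.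
by rewrite -addrA; apply: gen_idealD.
Qed.

Lemma gen_ideal_mul a b x : gen_ideal x -> gen_ideal (a * x * b).
Proof.
elim=> [|c s d z Ss _ IH]; first by rewrite mulr0 mul0r; apply: gen_ideal0.
by rewrite mulrDr mulrDl !mulrA -[_ * d * b]mulrA; apply: gen_idealD.
Qed.

Lemma gen_ideal_mem s : S s -> gen_ideal s.
Proof.
move=> Ss; rewrite -[s]addr0 -[s]mul1r -[1 * s]mulr1.
exact/gen_idealD/gen_ideal0.
Qed.

Lemma two_sided_ideal_zmod_closed : zmod_closed two_sided_ideal.
Proof.
split=> [|x y /asboolP Ix /asboolP Iy]; first exact/asboolP/gen_ideal0.
apply/asboolP/gen_ideal_add => //.
by rewrite -mulN1r -[_ * _]mulr1; apply: gen_ideal_mul.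
Qed.

HB.instance Definition _ :=
  GRing.isZmodClosed.Build A two_sided_ideal two_sided_ideal_zmod_closed.

Definition two_sided_zmod : zmodClosed A :=
  GRing.ZmodClosed.clone A two_sided_ideal _.

Definition ring_quot := Quotient.quot two_sided_zmod.

HB.instance Definition _ := GRing.Zmodule.on ring_quot.

Definition ring_quot_pi (x : A) : ring_quot := \pi_(Quotient.quot two_sided_zmod) x.
Local Notation piq := ring_quot_pi.

Lemma ring_quot_eqP x y : piq x = piq y <-> gen_ideal (x - y).
Proof.
split=> [/eqP|/asboolP Ixy]; last apply/eqP.
  by rewrite -Quotient.idealrBE => /asboolP.
by rewrite -Quotient.idealrBE.
Qed.

Lemma ring_quot_piB : zmod_morphism piq.
Proof.
move=> x y.
exact: (raddfB (\pi_(Quotient.quot two_sided_zmod) : {additive _ -> _}) x y).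
Qed.

HB.instance Definition _ :=
  GRing.isZmodMorphism.Build A ring_quot piq ring_quot_piB.

Definition ring_quot_repr (u : ring_quot) : A := repr u.

Lemma ring_quot_reprK : cancel ring_quot_repr piq.
Proof. by move=> u; apply: reprK. Qed.

Definition ring_quot_one : ring_quot := piq 1.
Definition ring_quot_mul (u v : ring_quot) : ring_quot :=
  piq (ring_quot_repr u * ring_quot_repr v).

Lemma ring_quot_piM x y : piq (x * y) = ring_quot_mul (piq x) (piq y).
Proof.
apply/ring_quot_eqP; set x' := ring_quot_repr _; set y' := ring_quot_repr _.
have Ix : gen_ideal (x - x') by apply/ring_quot_eqP; rewrite ring_quot_reprK.
have Iy : gen_ideal (y - y') by apply/ring_quot_eqP; rewrite ring_quot_reprK.
have -> : x * y - x' * y' = 1 * (x - x') * y + x' * (y - y') * 1.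
  by rewrite mul1r mulr1 mulrBl mulrBr addrA subrK.
by apply: gen_ideal_add; apply: gen_ideal_mul.
Qed.

Lemma ring_quot_mulA : associative ring_quot_mul.
Proof.
move=> u v w; rewrite -(ring_quot_reprK u) -(ring_quot_reprK v).
by rewrite -(ring_quot_reprK w) -!ring_quot_piM mulrA.
Qed.

Lemma ring_quot_mul1 : left_id ring_quot_one ring_quot_mul.
Proof. by move=> u; rewrite -(ring_quot_reprK u) -ring_quot_piM mul1r. Qed.

Lemma ring_quot_mulr1 : right_id ring_quot_one ring_quot_mul.
Proof. by move=> u; rewrite -(ring_quot_reprK u) -ring_quot_piM mulr1. Qed.

Lemma ring_quot_mulDl : left_distributive ring_quot_mul +%R.
Proof.
move=> u v w; rewrite -(ring_quot_reprK u) -(ring_quot_reprK v).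
by rewrite -(ring_quot_reprK w) -raddfD -!ring_quot_piM mulrDl raddfD.
Qed.

Lemma ring_quot_mulDr : right_distributive ring_quot_mul +%R.
Proof.
move=> u v w; rewrite -(ring_quot_reprK u) -(ring_quot_reprK v).
by rewrite -(ring_quot_reprK w) -raddfD -!ring_quot_piM mulrDr raddfD.
Qed.

HB.instance Definition _ := GRing.Zmodule_isPzRing.Build ring_quot
  ring_quot_mulA ring_quot_mul1 ring_quot_mulr1
  ring_quot_mulDl ring_quot_mulDr.

Lemma ring_quot_pi_monoid : monoid_morphism piq.
Proof. by split=> // x y; rewrite ring_quot_piM. Qed.

HB.instance Definition _ :=
  GRing.isMonoidMorphism.Build A ring_quot piq ring_quot_pi_monoid.

Lemma ring_quot_pi_rel s : S s -> piq s = 0.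
Proof.
move=> Ss; rewrite -(rmorph0 piq); apply/ring_quot_eqP.
by rewrite subr0; apply: gen_ideal_mem.
Qed.

Section Lift.
Variables (B : pzRingType) (f : {rmorphism A -> B}).
Hypothesis f_rel : forall s, S s -> f s = 0.

Definition ring_quot_lift (u : ring_quot) : B := f (ring_quot_repr u).

Lemma ring_quot_liftE x : ring_quot_lift (piq x) = f x.
Proof.
apply/eqP; rewrite -subr_eq0 -rmorphB; apply/eqP.
have : gen_ideal (ring_quot_repr (piq x) - x).
  by apply/ring_quot_eqP; rewrite ring_quot_reprK.
elim=> [|a s b z /f_rel s0 _ IH]; first exact: rmorph0.
by rewrite rmorphD !rmorphM s0 mulr0 mul0r add0r.
Qed.

Lemma ring_quot_lift_zmod : zmod_morphism ring_quot_lift.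
Proof.
move=> u v; rewrite -(ring_quot_reprK u) -(ring_quot_reprK v) -rmorphB.
by rewrite !ring_quot_liftE rmorphB.
Qed.

Lemma ring_quot_lift_monoid : monoid_morphism ring_quot_lift.
Proof.
split=> [|u v]; first by rewrite -(rmorph1 piq) ring_quot_liftE rmorph1.
rewrite -(ring_quot_reprK u) -(ring_quot_reprK v) -rmorphM.
by rewrite !ring_quot_liftE rmorphM.
Qed.

Definition ring_quot_lift_rmorph : {rmorphism ring_quot -> B} :=
  HB.pack ring_quot_lift
    (GRing.isZmodMorphism.Build ring_quot B ring_quot_lift ring_quot_lift_zmod)
    (GRing.isMonoidMorphism.Build ring_quot B ring_quot_lift
      ring_quot_lift_monoid).
End Lift.

End TwoSidedQuotient.

(* The ring End_k(M), product = composition. The library only provides it for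
   M != 0, whereas a module may be zero. *)
Definition endo (k : fieldType) (M : vectType k) := 'End(M).

Definition regular_space (k : fieldType) : vectType k := Vector.clone k k^o _.

Section Endo.
Variables (k : fieldType) (M : vectType k).

HB.instance Definition _ := GRing.Lmodule.on (endo M).
HB.instance Definition _ := GRing.Zmodule_isPzRing.Build (endo M)
  (@comp_lfunA _ _ _ _ _) (@comp_lfun1l _ _ _) (@comp_lfun1r _ _ _)
  (@comp_lfunDl _ _ _ _) (@comp_lfunDr _ _ _ _).

Definition endo_app (u : endo M) : M -> M := @fun_of_lfun k M M u.
Definition endo_img (u : endo M) : {vspace M} := @lfun_img k M M u fullv.

Lemma endo_eqP (u v : endo M) : endo_app u =1 endo_app v -> u = v.
Proof. by move=> uv; apply/lfunP. Qed.

Lemma endo_appD u v m : endo_app (u + v) m = endo_app u m + endo_app v m.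
Proof. exact: add_lfunE. Qed.

Lemma endo_appN u m : endo_app (- u) m = - endo_app u m.
Proof. exact: opp_lfunE. Qed.

Lemma endo_appZ c u m : endo_app (c *: u) m = c *: endo_app u m.
Proof. exact: scale_lfunE. Qed.

Lemma endo_app1 m : endo_app 1 m = m.
Proof. exact: id_lfunE. Qed.

Lemma endo_appM u v m : endo_app (u * v) m = endo_app u (endo_app v m).
Proof. exact: comp_lfunE. Qed.

Lemma endo_scaleAl (c : k) (f h : endo M) : c *: (f * h) = (c *: f) * h.
Proof. exact: comp_lfunZl. Qed.

Lemma endo_scaleAr (c : k) (f h : endo M) : c *: (f * h) = f * (c *: h).
Proof. exact: comp_lfunZr. Qed.
End Endo.

(* monalg shadows several mpoly notations, hence the module. *)
Module FreeAlgebra.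
Section FreeAlgebra.
Import xfinmap monalg BigEnoughFSet.
Variables (k : fieldType) (X : choiceType).

Definition free_alg := {malg k[{fmonom X}]}.
HB.instance Definition _ := GRing.NzRing.on free_alg.
HB.instance Definition _ := GRing.Lmodule.on free_alg.

Definition free_gen (x : X) : free_alg := << fmu x >>.
Definition free_scal (c : k) : free_alg := << c *g (@mone {fmonom X}) >>.

Variables (M : vectType k) (rho : X -> endo M).

Definition free_word (m : {fmonom X}) : endo M :=
  \prod_(x <- (m : seq X)) rho x.

Definition free_eval (a : free_alg) : endo M :=
  \sum_(m <- msupp a) mcoeff m a *: free_word m.

Lemma free_evalEw (d : {fset {fmonom X}}) (a : free_alg) :
  (msupp a `<=` d)%fset -> free_eval a = \sum_(m <- d) mcoeff m a *: free_word m.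
Proof.
move=> le; rewrite [LHS](big_fset_incl _ le) => //= x xd /mcoeff_outdom ->.
by rewrite scale0r.
Qed.

Lemma free_evalU c m : free_eval << c *g m >> = c *: free_word m.
Proof. by rewrite (free_evalEw msuppU_le) big_seq_fset1 mcoeffUU. Qed.

Lemma free_eval_zmod : zmod_morphism free_eval.
Proof.
move=> a b /=; pose_big_fset {fmonom X} E; rewrite 3?(free_evalEw (d := E)) //.
  by rewrite -sumrB; apply/eq_bigr=> m _; rewrite raddfB scalerBl.
by close.
Qed.
HB.instance Definition _ :=
  GRing.isZmodMorphism.Build free_alg (endo M) free_eval free_eval_zmod.

Lemma free_word1 : free_word (@mone {fmonom X}) = 1.
Proof. by rewrite /free_word fm1 big_nil. Qed.

Lemma free_wordM m n : free_word (mmul m n) = free_word m * free_word n.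
Proof. by rewrite /free_word fmM big_cat. Qed.

Lemma free_eval_monoid : monoid_morphism free_eval.
Proof.
split=> [|a b]; first by rewrite -[1]/(<< (1 : k) *g (@mone {fmonom X}) >>) free_evalU free_word1 scale1r.
rewrite [a * b]malgME raddf_sum mulr_suml /=; apply: eq_bigr=> i _.
rewrite raddf_sum mulr_sumr /=; apply: eq_bigr=> j _.
rewrite free_evalU free_wordM -endo_scaleAl -endo_scaleAr.
by rewrite scalerA.
Qed.
HB.instance Definition _ :=
  GRing.isMonoidMorphism.Build free_alg (endo M) free_eval free_eval_monoid.

Lemma free_eval_gen x : free_eval (free_gen x) = rho x.
Proof. by rewrite free_evalU scale1r /free_word fmU big_seq1. Qed.

Lemma free_eval_scal c : free_eval (free_scal c) = c *: (1 : endo M).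
Proof. by rewrite free_evalU free_word1. Qed.

End FreeAlgebra.
End FreeAlgebra.
Export FreeAlgebra.

Section Jacobson.
Variables (k : fieldType) (g : zmodType) (br : g -> g -> g) (x y : g).

(* coefficient of t^i in (ad (t x + y))^m (x), computed in g (x) k[t] *)
Fixpoint jacobson_coef (m i : nat) : g :=
  if m is m'.+1 then
    br y (jacobson_coef m' i) +
    (if i is i'.+1 then br x (jacobson_coef m' i') else 0)
  else if i is 0 then x else 0.
End Jacobson.

(* The p-map axioms are Jacobson's: with s_i defined by
   (ad (t x + y))^(p-1) (x) = sum_(1 <= i < p) i s_i(x, y) t^(i-1),
   (x + y)^[p] = x^[p] + y^[p] + sum_(1 <= i < p) s_i(x, y). *)
Record restrictedLie (k : fieldType) (p : nat) := RestrictedLie {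
  lie_sort :> vectType k;
  bracket : lie_sort -> lie_sort -> lie_sort;
  pmap : lie_sort -> lie_sort;
  bracketDl : forall (a : k) x y z,
    bracket (a *: x + y) z = a *: bracket x z + bracket y z;
  bracketDr : forall (a : k) x y z,
    bracket z (a *: x + y) = a *: bracket z x + bracket z y;
  bracketxx : forall x, bracket x x = 0;
  jacobi : forall x y z,
    bracket x (bracket y z) + bracket y (bracket z x)
      + bracket z (bracket x y) = 0;
  pmapZ : forall (a : k) x, pmap (a *: x) = a ^+ p *: pmap x;
  ad_pmap : forall x y, bracket (pmap x) y = iter p (bracket x) y;
  pmapD : forall x y, pmap (x + y) = pmap x + pmap y
    + \sum_(1 <= i < p) (i%:R : k)^-1 *: jacobson_coef bracket x y p.-1 i.-1 }.

Arguments bracket {k p r}.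
Arguments pmap {k p r}.

Section RestrictedEnveloping.
Variables (k : fieldType) (p : nat) (g : restrictedLie k p).

(* The first two families turn the free algebra on the set g into T(g). *)
Inductive env_rel : free_alg k g -> Prop :=
| env_relD x y :
    env_rel (free_gen k (x + y) - (free_gen k x + free_gen k y))
| env_relZ c x : env_rel (free_gen k (c *: x) - free_scal g c * free_gen k x)
| env_rel_bracket x y :
    env_rel (free_gen k x * free_gen k y - free_gen k y * free_gen k x
             - free_gen k (bracket x y)).

Definition env_alg := ring_quot env_rel.
HB.instance Definition _ := GRing.PzRing.on env_alg.

Definition env_gen (x : g) : env_alg := ring_quot_pi env_rel (free_gen k x).
Definition env_scal (c : k) : env_alg := ring_quot_pi env_rel (free_scal g c).

Inductive renv_rel : env_alg -> Prop :=
| renv_rel_pmap x : renv_rel (env_gen x ^+ p - env_gen (pmap x)).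

Definition renv_alg := ring_quot renv_rel.
HB.instance Definition _ := GRing.PzRing.on renv_alg.

Definition renv_gen (x : g) : renv_alg := ring_quot_pi renv_rel (env_gen x).
Definition renv_scal (c : k) : renv_alg := ring_quot_pi renv_rel (env_scal c).

(* renv_scal is the structure map of the k-algebra U_0(g) *)
Record renv_module (M : vectType k) := RenvModule {
  renv_act :> {rmorphism renv_alg -> endo M};
  renv_act_scal : forall c, renv_act (renv_scal c) = c *: (1 : endo M) }.

Definition op (M : vectType k) (rho : renv_module M) (x : g) : endo M :=
  rho (renv_gen x).

Section OpTheory.
Variables (M : vectType k) (rho : renv_module M).

Let sub0P (u v : endo M) : u - v = 0 -> u = v.
Proof. by move=> /eqP; rewrite subr_eq0 => /eqP. Qed.

Let op_env_rel a : env_rel a ->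
  rho (ring_quot_pi renv_rel (ring_quot_pi env_rel a)) = 0.
Proof. by move/ring_quot_pi_rel->; rewrite !rmorph0. Qed.

Lemma opD x y : op rho (x + y) = op rho x + op rho y.
Proof.
by have := op_env_rel (env_relD x y); rewrite !(rmorphB, rmorphD) => /sub0P.
Qed.

Lemma opZ c x : op rho (c *: x) = c *: op rho x.
Proof.
have := op_env_rel (env_relZ c x); rewrite !(rmorphB, rmorphM) => /sub0P.
by rewrite -/(env_scal c) -/(renv_scal c) renv_act_scal -endo_scaleAl mul1r.
Qed.

Lemma op_bracket x y :
  op rho (bracket x y) = op rho x * op rho y - op rho y * op rho x.
Proof.
have := op_env_rel (env_rel_bracket x y).
by rewrite !(rmorphB, rmorphM) => /sub0P.
Qed.

Lemma op_pmap x : op rho (pmap x) = op rho x ^+ p.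
Proof.
have := congr1 rho (ring_quot_pi_rel (renv_rel_pmap x)).
by rewrite !(rmorphB, rmorphXn, rmorph0) => /sub0P.
Qed.
End OpTheory.

Section LiftModule.
Variables (M : vectType k) (r : g -> endo M).
Hypothesis rD : forall x y, r (x + y) = r x + r y.
Hypothesis rZ : forall c x, r (c *: x) = c *: r x.
Hypothesis r_bracket : forall x y, r (bracket x y) = r x * r y - r y * r x.
Hypothesis r_pmap : forall x, r (pmap x) = r x ^+ p.

Lemma lift_env_rel a : env_rel a -> free_eval r a = 0.
Proof.
case=> [x y|c x|x y].
- by rewrite rmorphB rmorphD /= !free_eval_gen rD subrr.
- rewrite rmorphB rmorphM /= free_eval_scal !free_eval_gen rZ.
  by rewrite -endo_scaleAl mul1r subrr.
- by rewrite !rmorphB !rmorphM /= !free_eval_gen r_bracket subrr.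
Qed.

Definition env_lift : {rmorphism env_alg -> endo M} :=
  ring_quot_lift_rmorph lift_env_rel.

Lemma env_lift_gen x : env_lift (env_gen x) = r x.
Proof. by rewrite [LHS](ring_quot_liftE lift_env_rel) /= free_eval_gen. Qed.

Lemma lift_renv_rel a : renv_rel a -> env_lift a = 0.
Proof. by case=> x; rewrite rmorphB rmorphXn !env_lift_gen r_pmap subrr. Qed.

Definition renv_lift : {rmorphism renv_alg -> endo M} :=
  ring_quot_lift_rmorph lift_renv_rel.

Lemma renv_lift_gen x : renv_lift (renv_gen x) = r x.
Proof. by rewrite [LHS](ring_quot_liftE lift_renv_rel) env_lift_gen. Qed.

Lemma renv_lift_scal c : renv_lift (renv_scal c) = c *: (1 : endo M).
Proof.
rewrite [LHS](ring_quot_liftE lift_renv_rel).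
by rewrite [LHS](ring_quot_liftE lift_env_rel) /= free_eval_scal.
Qed.

Definition lift_module : renv_module M := RenvModule renv_lift_scal.

Lemma lift_moduleE x : op lift_module x = r x.
Proof. exact: renv_lift_gen. Qed.

End LiftModule.

End RestrictedEnveloping.

Definition dual_space (k : fieldType) (M : vectType k) : vectType k :=
  Vector.clone k 'Hom(M, regular_space k) _.

Section DualModule.
Variables (k : fieldType) (p : nat) (g : restrictedLie k p) (M : vectType k).

Local Notation dual := (dual_space M).

Definition neg_transpose (u : endo M) (f : dual) : dual :=
  - comp_lfun f u.

Lemma neg_transpose_linear u : linear (neg_transpose u).
Proof.
move=> a f h; rewrite /neg_transpose comp_lfunDl -comp_lfunZl opprD.
by rewrite scalerN.
Qed.
HB.instance Definition _ u := GRing.isLinear.Build k dual dual *:%R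
  (neg_transpose u) (neg_transpose_linear u).

Definition dual_op (u : endo M) : endo dual := linfun (neg_transpose u).

Lemma dual_opE (u : endo M) (f : dual) (m : M) :
  endo_app (dual_op u) f m = - f (endo_app u m).
Proof. by rewrite /endo_app lfunE /= opp_lfunE comp_lfunE. Qed.

Lemma dual_op_eqP (u v : endo dual) :
  (forall f m, endo_app u f m = endo_app v f m) -> u = v.
Proof. by move=> uv; apply: endo_eqP => f; apply/lfunP => m; apply: uv. Qed.

Lemma dual_opX (u : endo M) n (f : dual) (m : M) :
  endo_app (dual_op u ^+ n) f m = (-1) ^+ n *: f (endo_app (u ^+ n) m).
Proof.
elim: n m => [|n IH] m; first by rewrite !expr0 !endo_app1 scale1r.
rewrite exprS endo_appM dual_opE IH (exprSr u) endo_appM exprS.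
by rewrite mulN1r scaleNr.
Qed.

Hypothesis char_p : p \in [pchar k].
Variable rho : renv_module g M.

Definition dual_rep (x : g) : endo dual := dual_op (op rho x).

Lemma dual_repD x y : dual_rep (x + y) = dual_rep x + dual_rep y.
Proof.
apply: dual_op_eqP => f m; rewrite endo_appD add_lfunE !dual_opE.
by rewrite opD endo_appD linearD opprD.
Qed.

Lemma dual_repZ c x : dual_rep (c *: x) = c *: dual_rep x.
Proof.
apply: dual_op_eqP => f m; rewrite endo_appZ scale_lfunE !dual_opE.
by rewrite opZ endo_appZ linearZ scalerN.
Qed.

Lemma dual_rep_bracket x y :
  dual_rep (bracket x y) = dual_rep x * dual_rep y - dual_rep y * dual_rep x.
Proof.
apply: dual_op_eqP => f m; rewrite endo_appD endo_appN add_lfunE opp_lfunE.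
rewrite !endo_appM !dual_opE !opprK op_bracket endo_appD endo_appN.
by rewrite !endo_appM linearB opprB.
Qed.

Lemma dual_rep_pmap x : dual_rep (pmap x) = dual_rep x ^+ p.
Proof.
apply: dual_op_eqP => f m; rewrite dual_opX dual_opE op_pmap.
rewrite -[(-1) ^+ p](pFrobenius_autE char_p) pFrobenius_autN rmorph1.
by rewrite scaleN1r.
Qed.

Definition dual_module : renv_module g dual :=
  lift_module dual_repD dual_repZ dual_rep_bracket dual_rep_pmap.

Lemma op_dual_module x (f : dual) (m : M) :
  endo_app (op dual_module x) f m = - f (endo_app (op rho x) m).
Proof. by rewrite lift_moduleE dual_opE. Qed.
End DualModule.

Section Projective.
Variables (k : fieldType).

Definition coord_space (I : finType) : vectType k :=
  Vector.clone k {ffun I -> regular_space k} _.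

(* Points of P(W) are the lines of W, i.e. the one-dimensional elements of
   {vspace W}. A morphism U -> P(E), U contained in P(V), is given by a total
   function on {vspace W} of which only the values on U matter; homogeneous
   coordinates on P(V) come from vbasis V (the degree does not depend on this
   choice). *)

Definition gcd_is_one n (I : Type) (f : I -> {mpoly k[n]}) : Prop :=
  forall h, (forall i, exists q, f i = h * q) -> h \is a GRing.unit.

Definition morphism_has_degree (W : vectType k) (V : {vspace W})
    (I : finType) (U : pred {vspace W})
    (phi : {vspace W} -> {vspace coord_space I}) (d : nat) : Prop :=
  exists f : I -> {mpoly k[\dim V]},
    [/\ forall i, f i \is d.-homog, gcd_is_one f &
        forall x, x \in V -> x != 0 -> U <[x]>%VS ->
          let fx : coord_space I :=
            [ffun i => (f i).@[fun l => coord (vbasis V) l x]] in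
          fx != 0 /\ phi <[x]>%VS = <[fx]>%VS].

Definition morphism_degree (W : vectType k) (V : {vspace W})
    (I : finType) (U : pred {vspace W})
    (phi : {vspace W} -> {vspace coord_space I}) : nat :=
  if pselect (exists d, morphism_has_degree V U phi d) is left ex
  then sval (cid ex) else 0%N.

End Projective.

Section Pluecker.
Variables (k : fieldType) (M : vectType k) (d : nat).

(* Strictly increasing s index the basis e_(s 0) /\ ... /\ e_(s (d-1)) of
   the d-th exterior power of M, where e = vbasis {:M}; in this basis the
   coordinates of w_0 /\ ... /\ w_(d-1) are d x d minors. *)
Definition incr_fun := {s : {ffun 'I_d -> 'I_(\dim {:M})} |
  [forall i : 'I_d, forall l : 'I_d, (i < l)%N ==> (s i < s l)%N]}.
Definition incr_seq : finType := Finite.clone incr_fun _.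

Definition ext_power : vectType k := coord_space k incr_seq.

Definition wedge (w : 'I_d -> M) : ext_power :=
  [ffun s : incr_seq =>
    \det (\matrix_(i < d, l < d) coord (vbasis {:M}) (sval s l) (w i))].

Definition pluecker (W : {vspace M}) : {vspace ext_power} :=
  <[wedge (fun i => (vbasis W)`_i)]>%VS.

End Pluecker.

Section JRankDegree.
Variables (k : fieldType) (p : nat) (g : restrictedLie k p).

Definition nullcone : pred g := fun x => pmap x == 0.

Variables (M : vectType k) (rho : renv_module g M) (j : nat).

Definition op_rank (x : g) : nat := \dim (endo_img (op rho x ^+ j)).

Definition jrank : nat :=
  (\max_(r < (\dim {:M}).+1 |
         `[< exists2 x, x \in nullcone & op_rank x = r >]) r)%N.

Definition constant_jrank : Prop :=
  forall x y, x \in nullcone -> y \in nullcone -> x != 0 -> y != 0 ->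
    op_rank x = op_rank y.

(* vpick L spans the line L *)
Definition jrank_open (V : {vspace g}) : pred {vspace g} :=
  fun L => [&& (L <= V)%VS, \dim L == 1%N & op_rank (vpick L) == jrank].

Definition jimage (L : {vspace g}) : {vspace M} :=
  endo_img (op rho (vpick L) ^+ j).

Definition jdegree (V : {vspace g}) : nat :=
  if jrank == 0%N then 0%N
  else morphism_degree V (jrank_open V) (@pluecker k M jrank \o jimage).

End JRankDegree.

Arguments nullcone {k p} g.

(* Main.v *)
Require Import Defs.
From mathcomp Require Import all_boot all_order all_algebra.
From mathcomp Require Import perm boolp finmap mpoly.

(** For x in V(g) write x^j for the operator x_M^j and let C(x) be the matrix
    of its d x d minors, d = rk^j(M), with rows indexed through a basis of M
    predual to the chosen basis of the dual module and columns through the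
    chosen basis of M.  Where x^j has rank d, C(x) is the product of a column
    of Pluecker coordinates of im x^j on the dual module and a row of Pluecker
    coordinates of im x^j on M.  As polynomials in x the entries of C are
    homogeneous of degree j d and C has rank one, so unique factorization in
    k[X_1, ..., X_n] writes C as a product of a homogeneous column v and a
    homogeneous row u with deg u + deg v = j d.  Constant rank means that C,
    hence u and v, vanish nowhere outside the origin; as dim V(g) >= 2 and k is
    algebraically closed, their entries are then coprime, so that
    deg u = deg^j(M) and deg v = deg^j(M^* ). *)

Set Implicit Arguments.
Unset Strict Implicit.
Unset Printing Implicit Defensive.

Import GRing.Theory.
Local Open Scope ring_scope.

(** * GCD domains and Gauss's lemma *)

Section Divisibility.
Variable R : idomainType.
Implicit Types a b c d g : R.

Definition divides a b := exists q, b = a * q.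

Lemma divides_refl a : divides a a.
Proof. by exists 1; rewrite mulr1. Qed.

Lemma divides0 a : divides a 0.
Proof. by exists 0; rewrite mulr0. Qed.

Lemma divides_trans a b c : divides a b -> divides b c -> divides a c.
Proof. by move=> [q ->] [r ->]; exists (q * r); rewrite mulrA. Qed.

Lemma divides_mulr a b c : divides a b -> divides a (b * c).
Proof. by move=> [q ->]; exists (q * c); rewrite mulrA. Qed.

Lemma divides_mull a b c : divides a b -> divides a (c * b).
Proof. by rewrite mulrC; apply: divides_mulr. Qed.

Lemma divides_add a b c : divides a b -> divides a c -> divides a (b + c).
Proof. by move=> [q ->] [r ->]; exists (q + r); rewrite mulrDr. Qed.

Lemma divides_sub a b c : divides a b -> divides a c -> divides a (b - c).
Proof. by move=> [q ->] [r ->]; exists (q - r); rewrite mulrBr. Qed.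

Lemma divides_pmul2l c a b : c != 0 -> divides (c * a) (c * b) <-> divides a b.
Proof.
move=> c0; split=> [[q]|[q ->]]; last by exists q; rewrite mulrA.
by rewrite -mulrA => /(mulfI c0) ->; exists q.
Qed.

Definition gcd_spec (I : Type) (F : I -> R) g :=
  (forall i, divides g (F i)) /\
  forall c, (forall i, divides c (F i)) -> divides c g.

Definition gcd_domain := forall a b,
  exists g, gcd_spec (fun i : bool => if i then a else b) g.

Hypothesis gcdR : gcd_domain.

Lemma gcd_family_exists (I : finType) (F : I -> R) : exists g, gcd_spec F g.
Proof.
suff [g [g1 g2]] : exists g, (forall i, i \in enum I -> divides g (F i)) /\
   forall c, (forall i, i \in enum I -> divides c (F i)) -> divides c g.
  by exists g; split=> [i|c cF]; [apply: g1; rewrite mem_enum | apply: g2].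
elim: (enum I) => [|i s [g [g1 g2]]].
  by exists 0; split=> // c _; apply: divides0.
have [h [h1 h2]] := gcdR (F i) g; exists h; split=> [l|c cF].
  rewrite inE => /predU1P[->|ls]; first exact: (h1 true).
  exact: divides_trans (h1 false) (g1 _ ls).
apply: h2 => -[]; first by apply: cF; rewrite mem_head.
by apply: g2 => l ls; apply: cF; rewrite inE ls orbT.
Qed.

(** The family c F has some gcd h, and c divides it. Cancelling c in h = c q shows that q divides
    every [F i], hence g, so that h divides c g. *)
Lemma gcd_specM (I : finType) (F : I -> R) c g :
  gcd_spec F g -> gcd_spec (fun i => c * F i) (c * g).
Proof.
move=> [g1 g2]; have [->|c0] := eqVneq c 0.
  split=> [i|d]; first by rewrite !mul0r; apply: divides0.
  by move=> _; rewrite mul0r; apply: divides0.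
split=> [i|d dF]; first exact/divides_pmul2l.
have [h [h1 h2]] := gcd_family_exists (fun i => c * F i).
have [q hE] : divides c h by apply: h2 => i; exists (F i).
apply: divides_trans (h2 _ dF) _; rewrite hE; apply/divides_pmul2l => //.
by apply: g2 => i; have := h1 i; rewrite hE => /divides_pmul2l; apply.
Qed.

Lemma divides_of_coprime (I : finType) (F : I -> R) a b :
  gcd_spec F 1 -> (forall i, divides a (b * F i)) -> divides a b.
Proof. by move=> /(@gcd_specM _ _ b)[_]; rewrite mulr1; apply. Qed.

Lemma gcd_family_factor (I : finType) (F : I -> R) i0 : F i0 != 0 ->
  exists2 g, g != 0 & exists2 G : I -> R,
    (forall i, F i = g * G i) & gcd_spec G 1.
Proof.
move=> F0; have [g [g1 g2]] := gcd_family_exists F.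
have g0 : g != 0.
  by apply: contraNneq F0 => g0; have [q ->] := g1 i0; rewrite g0 mul0r.
have [G FE] : {G | forall i, F i = g * G i}.
  by exists (fun i => sval (cid (g1 i))) => i; case: cid.
exists g => //; exists G => //; split=> [i|c cG].
  by exists (G i); rewrite mul1r.
apply/(divides_pmul2l _ _ g0); rewrite mulr1; apply: g2 => i; rewrite FE.
exact/divides_pmul2l.
Qed.

(** Dividing a nonzero row by its gcd gives a coprime row [u]. The vanishing minors make [u l0]
    divide every [C i l0 * u l], hence [C i l0] by coprimality; the quotients form [v]. *)
Lemma rank_one_factor (I J : finType) (C : I -> J -> R) :
    (forall i i' l l', C i l * C i' l' = C i l' * C i' l) ->
  exists v : I -> R, exists u : J -> R, forall i l, C i l = v i * u l.
Proof.
move=> minor0; have [[i0 [l0 C0]]|C0] := pselect (exists i l, C i l != 0);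
  last first.
  exists (fun=> 0), (fun=> 0) => i l; rewrite mul0r; apply/eqP.
  by apply: contra_notT C0 => ?; exists i, l.
have [g g0 [u uE ucop]] := gcd_family_factor C0.
have cross i l l' : C i l * u l' = C i l' * u l.
  by apply: (mulfI g0); rewrite mulrCA -uE mulrCA -uE minor0 // mulrC.
have ul0 : u l0 != 0 by apply: contraNneq C0 => ul0; rewrite uE ul0 mulr0.
have dv i : divides (u l0) (C i l0).
  apply: (divides_of_coprime ucop) => l; rewrite cross.
  exact/divides_mull/divides_refl.
exists (fun i => sval (cid (dv i))), u => i l; case: cid => /= q qE.
by apply: (mulIf ul0); rewrite cross qE -mulrA mulrC.
Qed.

End Divisibility.

Section GaussLemma.
Variable R : idomainType.
Hypothesis gcdR : gcd_domain R.
Implicit Types (p q : {poly R}) (a c d e : R).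

Definition primitive p := gcd_spec (fun i : 'I_(size p) => p`_i) 1.

Lemma dividesC_coef c p : divides c%:P p <-> forall i, divides c p`_i.
Proof.
split=> [[q ->] i|cp]; first by rewrite coefCM; exists q`_i.
exists (\poly_(i < size p) sval (cid (cp i))); apply/polyP => i.
rewrite coefCM coef_poly; case: ifP => [_|/negbT]; first by case: cid.
by rewrite -leqNgt mulr0 => /(nth_default 0).
Qed.

Lemma dividesC_coef_size c p :
  divides c%:P p <-> forall i : 'I_(size p), divides c p`_i.
Proof.
rewrite dividesC_coef; split=> cp i //.
case: (ltnP i (size p)) => ip; first exact: (cp (Ordinal ip)).
by rewrite nth_default //; apply: divides0.
Qed.

Lemma dividesC_primitive p c a : primitive p ->
  divides c%:P (a%:P * p) -> divides c a.
Proof.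
move=> pp /dividesC_coef cap; apply: (divides_of_coprime gcdR pp) => i.
by rewrite -coefCM.
Qed.

Lemma dividesC a b : divides a%:P b%:P <-> divides a b.
Proof.
rewrite dividesC_coef; split=> [/(_ 0)|ab [|i]]; rewrite coefC //=.
exact: divides0.
Qed.

Lemma primitiveP p :
  (forall c, divides c%:P p -> divides c 1) -> primitive p.
Proof.
move=> pp; split=> [i|c cp]; first by exists p`_i; rewrite mul1r.
by apply: pp; apply/dividesC_coef_size.
Qed.

Lemma primitive_part p : p != 0 ->
  exists2 c, c != 0 & exists2 q, p = c%:P * q & primitive q.
Proof.
move=> p0; have sp : (0 < size p)%N by rewrite size_poly_gt0.
have lp : p`_(Ordinal (etrans (ltn_predL _) sp)) != 0.
  by rewrite /= -/(lead_coef p) lead_coef_eq0.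
have [c c0 [G pE Gcop]] :=
  gcd_family_factor gcdR (F := fun i : 'I_(size p) => p`_i) lp.
exists c => //; have [q pq] : divides c%:P p.
  by apply/dividesC_coef_size => i; exists (G i); apply: pE.
exists q => //; apply: primitiveP => d [r qr].
apply: (proj2 Gcop) => i; exists (r`_i); apply: (mulfI c0).
by rewrite -pE -!coefCM -qr; case: i => i _ /=; rewrite {1}pq.
Qed.

(** The zero polynomial has an empty coefficient family, of which 0 is a common divisor; 0 would
    then divide 1. *)
Lemma primitive_neq0 p : primitive p -> p != 0.
Proof.
move=> [_ pp]; apply/eqP => p0; move: pp; rewrite p0 => /(_ 0)[].
  by move=> [i]; rewrite size_poly0.
by move=> q; rewrite mul0r => /eqP; rewrite oner_eq0.
Qed.

(* A divisor d of both c and lead_coef p also divides q times the tail of p,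
   which by induction forces d to divide the tail, hence p. *)
Let primitive_mul_lead p q c d :
    (forall p', (size p' < size p)%N -> primitive p' -> primitive (p' * q)) ->
    primitive p -> divides c%:P (p * q) ->
  divides d c -> divides d (lead_coef p) -> divides d 1.
Proof.
move=> IH pp cpq dc dl; apply: (dividesC_primitive pp).
rewrite mul1r; pose t := p - lead_coef p *: 'X^((size p).-1).
have dlt : divides d%:P (lead_coef p *: 'X^((size p).-1)).
  by rewrite -mul_polyC; apply/divides_mulr/dividesC.
have pE : p = lead_coef p *: 'X^((size p).-1) + t by rewrite addrC subrK.
rewrite pE; apply: divides_add => //.
have [->|t0] := eqVneq t 0; first exact: divides0.
have st : (size t < size p)%N.
  rewrite -[X in (_ < X)%N](prednK (n := size p)) ?size_poly_gt0 ?primitive_neq0 //.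
  rewrite ltnS; apply/leq_sizeP => i; rewrite leq_eqVlt => /predU1P[<-|ip].
    by rewrite coefB coefZ coefXn eqxx mulr1 subrr.
  rewrite coefB coefZ coefXn gtn_eqF // mulr0 subr0 nth_default //.
  by case: (size p) ip.
have [e e0 [t1 tE t1p]] := primitive_part t0.
have st1 : (size t1 < size p)%N by move: st; rewrite tE mul_polyC size_scale.
rewrite tE; apply/divides_mulr/dividesC.
apply: (dividesC_primitive (IH _ st1 t1p)).
rewrite mulrA -tE /t mulrBl; apply: divides_sub; last exact: divides_mulr.
apply: divides_trans cpq; exact/dividesC.
Qed.

(** Gauss's lemma, by induction on the sizes. A constant c dividing p q divides the product of the
    leading coefficients. It is coprime to that of p, so it divides that of q, and therefore 1. *)
Lemma primitiveM p q : primitive p -> primitive q -> primitive (p * q).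
Proof.
have [n] := ubnP (size p + size q)%N; elim: n => // n IH in p q *.
rewrite ltnS => le_n pp qp; apply: primitiveP => c cpq.
have cl : divides c (lead_coef p * lead_coef q).
  by move/dividesC_coef: cpq => /(_ (size (p * q)).-1);
    rewrite -/(lead_coef _) lead_coefM.
have lp d : divides d c -> divides d (lead_coef p) -> divides d 1.
  apply: (primitive_mul_lead _ pp cpq) => p' sp' p'p; apply: IH => //.
  by apply: leq_trans le_n; rewrite ltn_add2r.
have lq d : divides d c -> divides d (lead_coef q) -> divides d 1.
  apply: (primitive_mul_lead _ qp (q := p)); last by rewrite mulrC.
  move=> q' sq' q'p; rewrite mulrC; apply: IH => //.
  by apply: leq_trans le_n; rewrite ltn_add2l.
apply: lq; first exact: divides_refl.
apply: (divides_of_coprime gcdR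
  (F := fun b : bool => if b then c else lead_coef p)).
  split=> [b|d dF]; first by eexists; rewrite mul1r.
  exact: lp (dF true) (dF false).
by case=> //; [apply/divides_mull/divides_refl | rewrite mulrC].
Qed.

(** The relation [%|] only yields c q = r p for some nonzero scalar c. The primitive part of r times
    p is primitive, so c divides the content of r and cancels. *)
Lemma primitive_divides p q : primitive p -> p %| q -> divides p q.
Proof.
move=> pp; have p0 := primitive_neq0 pp.
case/Pdiv.Idomain.dvdpP => [[c r]] /= c0 qE.
have [->|q0] := eqVneq q 0; first exact: divides0.
have r0 : r != 0.
  apply: contraNneq q0 => r0; move: qE; rewrite r0 mul0r => /eqP.
  by rewrite scale_poly_eq0 (negPf c0).
have [e e0 [r1 rE r1p]] := primitive_part r0.
have [f eE] : divides c e.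
  apply: (dividesC_primitive (primitiveM r1p pp)).
  by rewrite mulrA -rE -qE -mul_polyC; apply/divides_mulr/divides_refl.
exists (f%:P * r1); apply: (@mulfI _ c%:P); first by rewrite polyC_eq0.
by rewrite [LHS]mul_polyC qE rE eE polyCM [p * _]mulrC !mulrA.
Qed.

(** [gcdp] is a gcd only up to scalars. The true gcd is the gcd of the two contents times the
    primitive part of [gcdp p q]. *)
Lemma poly_gcd_domain : gcd_domain {poly R}.
Proof.
move=> p q; have [p0|p0] := eqVneq p 0.
  exists q; split=> [[]|c /(_ false) //]; rewrite ?p0; first exact: divides0.
  exact: divides_refl.
have [q0|q0] := eqVneq q 0.
  exists p; split=> [[]|c /(_ true) //]; rewrite ?q0; last exact: divides0.
  exact: divides_refl.
have g0 : gcdp p q != 0 by rewrite gcdp_eq0 (negPf p0).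
have [a a0 [p1 pE p1p]] := primitive_part p0.
have [b b0 [q1 qE q1p]] := primitive_part q0.
have [e e0 [g1 gE g1p]] := primitive_part g0.
have [h [h1 h2]] := gcdR a b.
have g1g : g1 %| gcdp p q by rewrite gE dvdp_mull.
have dvd1 s s1 (c : R) : c != 0 -> s = c%:P * s1 -> gcdp p q %| s -> divides g1 s1.
  move=> c0 sE gs; apply: (primitive_divides g1p).
  have := dvdp_trans g1g gs; rewrite sE mul_polyC dvdpZr //.
exists (h%:P * g1); split=> [[]|c cpq].
- have [r p1E] := dvd1 _ _ _ a0 pE (dvdp_gcdl p q); have [f aE] := h1 true.
  by exists (f%:P * r); rewrite pE p1E aE polyCM mulrACA.
- have [r q1E] := dvd1 _ _ _ b0 qE (dvdp_gcdr p q); have [f bE] := h1 false.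
  by exists (f%:P * r); rewrite qE q1E bE polyCM mulrACA.
have c0 : c != 0.
  by apply: contraNneq p0 => c0; have [r /= ->] := cpq true; rewrite c0 mul0r.
have [d d0 [c1 cE c1p]] := primitive_part c0.
have [f hE] : divides d h.
  apply: h2 => -[].
    apply: (dividesC_primitive p1p); rewrite -pE; apply: divides_trans (cpq true).
    by exists c1.
  apply: (dividesC_primitive q1p); rewrite -qE; apply: divides_trans (cpq false).
  by exists c1.
have [r gr] : divides c1 g1.
  apply: (primitive_divides c1p).
  have : c1 %| gcdp p q.
    rewrite dvdp_gcd; have [r /= ->] := cpq true; have [r' /= ->] := cpq false.
    by rewrite cE -!mulrA [X in X && _]dvdp_mull
      ?[X in _ && X]dvdp_mull // dvdp_mulr.
  by rewrite gE mul_polyC dvdpZr.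
by exists (f%:P * r); rewrite hE gr cE polyCM mulrACA.
Qed.

End GaussLemma.

(** * Multivariate polynomials over an algebraically closed field *)

Local Notation widen := (widen_ord (leqnSn _)).

Section Multi.
Variables (n : nat) (R : comNzRingType).

(** The inverse of the isomorphism [muni]: the outer variable becomes the last one. *)
Definition multi_horner (P : {poly {mpoly R[n]}}) : {mpoly R[n.+1]} :=
  (map_poly (@mwiden n R) P).['X_ord_max].

Lemma multi_hornerM P Q :
  multi_horner (P * Q) = multi_horner P * multi_horner Q.
Proof. by rewrite /multi_horner rmorphM hornerM. Qed.

Lemma multi_hornerD P Q :
  multi_horner (P + Q) = multi_horner P + multi_horner Q.
Proof. by rewrite /multi_horner rmorphD hornerD. Qed.

Lemma multi_hornerC c : multi_horner c%:P = mwiden c.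
Proof. by rewrite /multi_horner map_polyC hornerC. Qed.

Lemma multi_hornerX : multi_horner 'X = 'X_ord_max.
Proof. by rewrite /multi_horner map_polyX hornerX. Qed.

Lemma muniX_widen (i : 'I_n) : muni ('X_(widen i) : {mpoly R[n.+1]}) = ('X_i)%:P.
Proof.
rewrite muniE msuppX big_seq1 mcoeffX eqxx scale1r.
rewrite mnm1E (_ : (widen i == ord_max) = false) ?expr0; last first.
  by apply/eqP => /(congr1 val) /= E; have := ltn_ord i; rewrite E ltnn.
rewrite alg_polyC; congr ('X_[_])%:P; apply/mnmP => l.
by rewrite mnmE !mnm1E.
Qed.

Lemma muniX_max : muni ('X_ord_max : {mpoly R[n.+1]}) = 'X.
Proof.
rewrite muniE msuppX big_seq1 mcoeffX eqxx scale1r mnm1E eqxx expr1.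
rewrite (_ : [multinom _ | _ < _] = 0%MM) ?mpolyX0 ?scale1r //.
apply/mnmP => l; rewrite mnmE mnm1E mnm0E.
by case: eqP => // /(congr1 val) /= E; have := ltn_ord l; rewrite -E ltnn.
Qed.

Lemma muni_mwiden (p : {mpoly R[n]}) : muni (mwiden p) = p%:P.
Proof.
elim/mpolyind: p => [|c m p _ _ IH]; first by rewrite mwiden0 muni0.
rewrite mwidenD muniD IH polyCD mwidenZ muniZ -mul_polyC.
congr (_ + _); rewrite -mul_mpolyC polyCM; congr (_ * _).
rewrite mpolyXE_id !rmorph_prod /=; apply: eq_bigr => i _.
by rewrite 3!rmorphXn /= mwidenX mnmwiden1 muniX_widen.
Qed.

Lemma multi_hornerK : cancel multi_horner (@muni n R).
Proof.
elim/poly_ind => [|P c IH].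
  by rewrite -[0]polyC0 multi_hornerC mwiden0 muni0.
rewrite multi_hornerD multi_hornerM multi_hornerC multi_hornerX.
by rewrite muniD muniM IH muniX_max muni_mwiden.
Qed.

Lemma muniK : cancel (@muni n R) multi_horner.
Proof.
elim/mpolyind => [|c m p _ _ IH].
  by rewrite muni0 -[0]polyC0 multi_hornerC mwiden0.
rewrite muniD multi_hornerD IH; congr (_ + _).
rewrite -mul_mpolyC muniM muniC multi_hornerM multi_hornerC mwidenC.
congr (_ * _).
rewrite {2}mpolyXE_id mpolyXE_id rmorph_prod /=.
have mh1 : multi_horner 1 = 1 by rewrite -[1]polyC1 multi_hornerC mwiden1.
rewrite (big_morph _ multi_hornerM mh1).
apply: eq_bigr => i _; rewrite rmorphXn /=.
elim: (m i) => [|e IHe]; first by rewrite !expr0 mh1.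
rewrite !exprS multi_hornerM IHe; congr (_ * _).
have [i' ->|->] := unliftP ord_max i; last by rewrite muniX_max multi_hornerX.
have -> : lift ord_max i' = widen i'.
  by apply/val_inj; rewrite /= /bump leqNgt ltn_ord.
by rewrite muniX_widen multi_hornerC mwidenX mnmwiden1.
Qed.

Lemma meval_multi_horner (v : 'I_n -> R) (a : R) (w : 'I_n.+1 -> R) P :
    (forall i, w (widen i) = v i) -> w ord_max = a ->
  (multi_horner P).@[w] = (map_poly (meval v) P).[a].
Proof.
move=> wv wa; have mw c : (mwiden c).@[w] = c.@[v].
  elim/mpolyind: c => [|c m p _ _ IH]; first by rewrite mwiden0 !meval0.
  rewrite mwidenD !mevalD IH mwidenZ !mevalZ mwidenX !mevalX; congr (_ * _ + _).
  rewrite big_ord_recr /= mnmwiden_ordmax expr0 mulr1.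
  by apply: eq_bigr => i _; rewrite mnmwiden_widen wv.
elim/poly_ind: P => [|P c IH].
  by rewrite rmorph0 horner0 -[0]polyC0 multi_hornerC mw meval0.
rewrite multi_hornerD multi_hornerM multi_hornerC multi_hornerX mevalD mevalM IH.
by rewrite rmorphD rmorphM /= map_polyX map_polyC hornerMXaddC mw mevalXU wa.
Qed.

End Multi.

Lemma field_gcd_domain (R : idomainType) :
  (forall a : R, a != 0 -> divides a 1) -> gcd_domain R.
Proof.
move=> inv a b; have [a0|a0] := eqVneq a 0.
  exists b; split=> [[]|c /(_ false) //]; rewrite ?a0; first exact: divides0.
  exact: divides_refl.
exists 1; split=> [i|c /(_ true) [q aE]]; first by eexists; rewrite mul1r.
by apply: inv; apply: contraNneq a0 => c0; rewrite aE c0 mul0r.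
Qed.

(** Induction on n: [muni] identifies polynomials in n + 1 variables with univariate ones over a
    ring that is a gcd domain by induction. *)
Lemma mpoly_gcd_domain (k : fieldType) n : gcd_domain {mpoly k[n]}.
Proof.
elim: n => [|n IH].
  apply: field_gcd_domain => a; rewrite (nvar0_mpolyC a) mpolyC_eq0 => a0.
  by exists (a@_0)^-1%:MP; rewrite -mpolyCM divff.
have dv p q : divides p q <-> divides (muni p) (muni q).
  split=> [[r ->]|[r E]]; first by exists (muni r); rewrite muniM.
  by exists (multi_horner r); rewrite -[LHS]muniK E multi_hornerM muniK.
move=> p q; have [g [g1 g2]] := poly_gcd_domain IH (muni p) (muni q).
exists (multi_horner g); split=> [i|c cpq].
  by apply/dv; rewrite multi_hornerK; have := g1 i; case: i.
by apply/dv; rewrite multi_hornerK; apply: g2 => -[]; apply/dv;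
  [apply: (cpq true) | apply: (cpq false)].
Qed.

Lemma closed_field_fresh (k : closedFieldType) (s : seq k) : exists a, a \notin s.
Proof.
(* This polynomial takes the value 1 on s, so its roots lie outside s. The extra factor ['X] keeps
   it nonconstant when s is empty. *)
pose p := \prod_(a <- s) ('X - a%:P) * 'X + 1 : {poly k}.
have sp : size (\prod_(a <- s) ('X - a%:P) * 'X) = (size s).+2.
  by rewrite size_mulX ?monic_neq0 ?monic_prod_XsubC // size_prod_XsubC.
have /closed_rootP[x] : size p != 1%N by rewrite size_polyDl ?sp // size_poly1.
rewrite /root /p hornerD hornerM hornerC => px; exists x.
apply: contraTN px => xs; rewrite horner_prod.
rewrite (_ : \prod_(a <- s) _ = 0) ?mul0r ?add0r ?oner_eq0 //.
by apply/eqP; rewrite prodf_seq_eq0; apply/hasP; exists x => //=;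
  rewrite !hornerE subrr.
Qed.

(** By induction the leading coefficient in the last variable is nonzero at some point; the last
    coordinate then only has to avoid finitely many roots. *)
Lemma mpoly_nonzero_value (k : closedFieldType) n (p : {mpoly k[n]}) :
  p != 0 -> exists v, p.@[v] != 0.
Proof.
elim: n p => [|n IH] p p0.
  exists (fun=> 0); rewrite (nvar0_mpolyC p) mevalC.
  by move: p0; rewrite {1}(nvar0_mpolyC p) mpolyC_eq0.
have P0 : muni p != 0.
  by apply: contraNneq p0 => E; rewrite -(muniK p) E -[0]polyC0 multi_hornerC mwiden0.
have /IH[v vP] : lead_coef (muni p) != 0 by rewrite lead_coef_eq0.
pose Q := map_poly (meval v) (muni p).
have Q0 : Q != 0.
  apply: contraNneq vP => /(congr1 (fun q : {poly k} => q`_(size (muni p)).-1)).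
  by rewrite coef_map coef0 => /eqP.
have [rs rsE] := closed_field_poly_normal Q.
have [a a_rs] := closed_field_fresh rs.
pose w (i : 'I_n.+1) := if unlift ord_max i is Some i' then v i' else a.
exists w; rewrite -(muniK p) (@meval_multi_horner _ _ v a).
- by rewrite -[_ == 0]/(root Q a) rsE rootZ ?lead_coef_eq0 // root_prod_XsubC.
- move=> i; rewrite /w.
  have <- : lift ord_max i = widen i.
    by apply/val_inj; rewrite /= /bump leqNgt ltn_ord.
  by rewrite liftK.
- by rewrite /w unlift_none.
Qed.

Definition nonzero_pt (k : fieldType) n (v : 'I_n -> k) := exists i, v i != 0.

(** If p - q is nonzero, so is its product with the first variable. A point where this product does
    not vanish has a nonzero first coordinate, hence is not the origin. *)
Lemma mpoly_eq_on_nonzero (k : closedFieldType) n (p q : {mpoly k[n]}) :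
    (0 < n)%N -> (forall v, nonzero_pt v -> p.@[v] = q.@[v]) -> p = q.
Proof.
move=> n0 pq; apply/eqP; rewrite -subr_eq0; apply: contraPT pq => pq0 pq.
pose i0 := Ordinal n0.
have /mpoly_nonzero_value[v] : (p - q) * 'X_i0 != 0.
  by rewrite mulf_neq0 // -msupp_eq0 msuppX.
rewrite mevalM mevalXU mevalB mulf_eq0 negb_or => /andP[+ v0].
by rewrite pq ?subrr ?eqxx //; exists i0.
Qed.

Section Nonvanishing.
Variables (k : closedFieldType) (n : nat) (h : {mpoly k[n]}).
Hypothesis n_gt1 : (1 < n)%N.
Hypothesis h_nz : forall v, nonzero_pt v -> h.@[v] != 0.

(* On a line avoiding the origin a polynomial without zeros is constant. *)
Lemma nonvanishing_line (v w : 'I_n -> k) :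
    (forall t, nonzero_pt (fun i => v i + t * w i)) ->
  h.@[fun i => v i + w i] = h.@[v].
Proof.
move=> vw; pose P : {poly k} := mmap polyC (fun i => (v i)%:P + w i *: 'X) h.
have PE t : P.[t] = h.@[fun i => v i + t * w i].
  rewrite /P /meval /mmap horner_sum; apply: eq_bigr => m _.
  rewrite hornerM hornerC; congr (_ * _); rewrite /mmap1 horner_prod.
  by apply: eq_bigr => i _; rewrite horner_exp !hornerE mulrC.
have /eqP/size_poly1P[c c0 Pc] : size P = 1%N.
  apply/eqP; apply: contraTT isT => /closed_rootP[t].
  by rewrite /root PE (negPf (h_nz (vw t))).
have := PE 1; have := PE 0; rewrite Pc !hornerC => E0 E1.
transitivity c; [rewrite E1 | rewrite E0]; apply: meval_eq => i.
  by rewrite mul1r.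
by rewrite mul0r addr0.
Qed.

(** In at least two variables any two nonzero points are joined by lines avoiding the origin, so h
    is a nonzero constant. In one variable the monomial X is a counterexample. *)
Lemma nonvanishing_unit : h \is a GRing.unit.
Proof.
have n0 : (0 < n)%N by apply: ltn_trans n_gt1.
pose e (i : 'I_n) := fun l => (l == i)%:R : k.
pose i0 := Ordinal n0; pose i1 := Ordinal n_gt1.
have key (i l : 'I_n) (v : 'I_n -> k) : i != l -> v i != 0 ->
    h.@[v] = h.@[e l].
  move=> il vi.
  (* The lines from v to v + (1 - v l) e_l and on to e_l avoid the origin. *)
  transitivity h.@[fun s => v s + (1 - v l) * e l s].
    apply/esym/(nonvanishing_line (w := fun s => (1 - v l) * e l s)) => t.
    by exists i; rewrite /e (negPf il) !mulr0 addr0.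
  set v' := fun s => _; have v'l : v' l = 1 by rewrite /v' /e eqxx mulr1 addrC subrK.
  rewrite -(nonvanishing_line (v := v') (w := fun s => e l s - v' s)).
    by apply: meval_eq => s; rewrite addrC subrK.
  by move=> t; exists l; rewrite v'l /e eqxx subrr mulr0 addr0 oner_eq0.
have e1 (i : 'I_n) : e i i != 0 by rewrite /e eqxx oner_eq0.
have i01 : i0 != i1 by [].
(* [key] needs a nonzero coordinate other than the target index; if [i0] is the one at hand, the
   path goes through [e i1]. *)
have hc v : nonzero_pt v -> h.@[v] = h.@[e i0].
  move=> [i vi]; have [ii0|] := eqVneq i i0; last by move=> ?; apply: key vi.
  by rewrite ii0 in vi; rewrite (key i0 i1 v) // (key i1 i0 (e i1)) // eq_sym.
have -> : h = (h.@[e i0])%:MP.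
  by apply: mpoly_eq_on_nonzero => // v /hc; rewrite mevalC.
have := h_nz (ex_intro _ i0 (e1 i0)).
set c := h.@[_] => c0; apply/unitrP; exists c^-1%:MP.
by rewrite -!mpolyCM mulVf ?divff.
Qed.

End Nonvanishing.

(** * Minors, Pluecker coordinates and duality *)

Section HomogeneousFactor.
Variables (k : fieldType) (n : nat).
Implicit Types p q : {mpoly k[n]}.

(** With degrees bounded by a and b, only the pair of top components reaches degree a + b. *)
Lemma pihomog_topM a b p q : (msize p <= a.+1)%N -> (msize q <= b.+1)%N ->
  pihomog mdeg (a + b) (p * q) = pihomog mdeg a p * pihomog mdeg b q.
Proof.
move=> pa qb; rewrite {1}(pihomog_partitionE pa) {1}(pihomog_partitionE qb).
rewrite big_distrlr /= raddf_sum big_ord_recr /= big1 ?add0r => [|i _].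
  rewrite raddf_sum big_ord_recr /= big1 ?add0r => [|l _].
    by rewrite pihomog_dE // dhomogM // pihomogP.
  rewrite (@pihomog_ne0 _ _ _ (a + l)%N) ?dhomogM ?pihomogP //.
  by rewrite eqn_add2l ltn_eqF.
rewrite raddf_sum big1 //= => l _.
rewrite (@pihomog_ne0 _ _ _ (i + l)%N) ?dhomogM ?pihomogP //.
by rewrite ltn_eqF // -addSn leq_add // -ltnS.
Qed.

(** Any factorization of C can be made homogeneous: passing to the components of the largest degrees
    occurring in v and in u does not affect the products, since these are already homogeneous of
    degree D. *)
Lemma homog_rank_one_factor (I J : finType) (C : I -> J -> {mpoly k[n]}) D i0 l0 :
    C i0 l0 != 0 -> (forall i l, C i l \is D.-homog) ->
    (forall i i' l l', C i l * C i' l' = C i l' * C i' l) ->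
  exists m m' (v : I -> {mpoly k[n]}) (u : J -> {mpoly k[n]}),
    [/\ (m + m' = D)%N, forall i, v i \is m.-homog, forall l, u l \is m'.-homog
      & forall i l, C i l = v i * u l].
Proof.
move=> C0 homC minor0.
have [v [u CE]] := rank_one_factor (@mpoly_gcd_domain k n) minor0.
have [v0 u0] : v i0 != 0 /\ u l0 != 0.
  by apply/andP; rewrite -negb_or -mulf_eq0 -CE.
pose i1 := [arg max_(i > i0) msize (v i)].
pose l1 := [arg max_(l > l0) msize (u l)].
have [vmax umax] : (forall i, (msize (v i) <= msize (v i1))%N) /\
                   (forall l, (msize (u l) <= msize (u l1))%N).
  by rewrite /i1 /l1; do 2!case: arg_maxnP => //=; split=> ?; auto.
have v1 : v i1 != 0.
  by rewrite -msize_poly_eq0 -lt0n (leq_trans _ (vmax i0)) // lt0n msize_poly_eq0.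
have u1 : u l1 != 0.
  by rewrite -msize_poly_eq0 -lt0n (leq_trans _ (umax l0)) // lt0n msize_poly_eq0.
(* [msize] is the degree plus one. The entry at [i1], [l1] is a product of nonzero factors of
   degrees a and b, which forces a + b = D. *)
pose a := (msize (v i1)).-1; pose b := (msize (u l1)).-1.
have va i : (msize (v i) <= a.+1)%N by rewrite -mpolySpred.
have ub l : (msize (u l) <= b.+1)%N by rewrite -mpolySpred.
have abD : (a + b = D)%N.
  have C1 : C i1 l1 != 0 by rewrite CE mulf_neq0.
  have := dhomog_msize (homC i1 l1); move/(dhomog_uniq C1 (homC i1 l1)) => ->.
  by rewrite CE msizeM // (mpolySpred _ v1) (mpolySpred _ u1) addSn addnS.
exists a, b, (fun i => pihomog mdeg a (v i)), (fun l => pihomog mdeg b (u l)).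
split=> // [i|l|i l]; try exact: pihomogP.
by rewrite -pihomog_topM // -CE abD pihomog_dE.
Qed.

End HomogeneousFactor.

Section IncreasingMinor.
Variables (k : fieldType) (N d : nat).

(** A left inverse gives c rank d, so d of its rows are independent; [enum] lists their indices in
    increasing order. *)
Lemma incr_minor_neq0 (c : 'M[k]_(N, d)) (c' : 'M_(d, N)) : c' *m c = 1%:M ->
  exists2 t : {ffun 'I_d -> 'I_N},
    [forall i : 'I_d, forall l : 'I_d, (i < l)%N ==> (t i < t l)%N]
    & \det (\matrix_(i, l) c (t i) l) != 0.
Proof.
move=> c'c; have cfull : row_full c by apply/row_fullP; exists c'.
pose f := fullrankfun cfull; pose A := [set f i | i in 'I_d].
have sA : size (enum A) = d.
  by rewrite -cardE card_imset ?card_ord //; apply: fullrankfun_inj.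
pose t := [ffun i : 'I_d => nth (f i) (enum A) i].
have tnth i : t i = nth (f i) (enum A) i by exact: ffunE.
exists t.
  apply/forallP => i; apply/forallP => l; apply/implyP => il; rewrite !tnth.
  have sorted_A : sorted ltn (map val (enum A)).
    rewrite (subseq_sorted ltn_trans (map_subseq _ (filter_subseq _ _))) //.
    by rewrite -enumT val_enum_ord iota_ltn_sorted.
  have := sorted_ltn_nth ltn_trans 0%N sorted_A i l.
  rewrite !inE !size_map sA !ltn_ord => /(_ isT isT il).
  by rewrite (nth_map (f i)) ?sA // (nth_map (f l)) ?sA.
have tE : \matrix_(i, l) c (t i) l = rowsub t c.
  by apply/matrixP => i l; rewrite !mxE.
rewrite tE -unitfE -unitmxE -row_full_unit -sub1mx.
apply: submx_trans (_ : rowsub f c <= _)%MS.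
  by rewrite sub1mx; apply: fullrowsub_full.
apply/row_subP => i; rewrite row_rowsub.
have fA : f i \in enum A by rewrite mem_enum imset_f.
have lt_i : (index (f i) (enum A) < d)%N by rewrite -[X in (_ < X)%N]sA index_mem.
have -> : f i = t (Ordinal lt_i) by rewrite tnth nth_index.
by rewrite -row_rowsub; apply: row_sub.
Qed.

End IncreasingMinor.

Lemma vlineZ (k : fieldType) (E : vectType k) (a : k) (v : E) : a != 0 ->
  <[a *: v]>%VS = <[v]>%VS.
Proof.
move=> a0; apply/eqP; rewrite eqEsubv -!memvE; apply/andP.
split; apply/vlineP; first by exists a.
by exists a^-1; rewrite scalerA mulVf // scale1r.
Qed.

Section Wedge.
Variables (k : fieldType) (M : vectType k) (U : {vspace M}).

(** The factorization has inner size dim U. This bounds the rank of the minors and, when dim U = d,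
    turns them into multiples of the Pluecker coordinates of U. *)
Lemma wedge_coord d (w : 'I_d -> M) (s : incr_seq M d) : (forall i, w i \in U) ->
  \matrix_(i, l) coord (vbasis {:M}) (sval s l) (w i) =
  (\matrix_(i, r) coord (vbasis U) r (w i)) *m
  (\matrix_(r, l) coord (vbasis {:M}) (sval s l) (vbasis U)`_r).
Proof.
move=> wU; apply/matrixP => i l; rewrite !mxE {1}(coord_vbasis (wU i)) linear_sum.
by apply: eq_bigr => r _; rewrite !mxE linearZ.
Qed.

Lemma wedge_dim d (w : 'I_d -> M) : (forall i, w i \in U) -> wedge w != 0 ->
  (d <= \dim U)%N.
Proof.
move=> wU; apply: contraNT; rewrite -ltnNge => lt_d.
apply/eqP/ffunP => s; rewrite !ffunE (wedge_coord s wU).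
apply/eqP/negPn/negP; rewrite -unitfE -unitmxE -row_free_unit => /eqP rk.
move: lt_d; rewrite ltnNge -[X in (X <= _)%N]rk.
by rewrite (leq_trans (mxrankM_maxl _ _)) ?rank_leq_col.
Qed.

Lemma pluecker_wedge d (w : 'I_d -> M) : \dim U = d -> (forall i, w i \in U) ->
  wedge w != 0 -> pluecker d U = <[wedge w]>%VS.
Proof.
move=> dU; case: d / dU in w * => wU w0.
pose L := \matrix_(i, r) coord (vbasis U) r (w i).
have wE : wedge w = \det L *: wedge (fun i => (vbasis U)`_i).
  by apply/ffunP => s; rewrite !ffunE (wedge_coord s wU) det_mulmx.
have L0 : \det L != 0 by apply: contraNneq w0 => L0; rewrite wE L0 scale0r.
by rewrite wE vlineZ.
Qed.

End Wedge.

Section DualImage.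
Variables (k : fieldType) (M : vectType k).
Local Notation dual := (dual_space M).

Definition functional (f : {linear M -> k^o}) : dual :=
  linfun (f : M -> regular_space k).

Lemma functionalE f v : functional f v = f v.
Proof. exact: lfunE. Qed.

Definition dual_coord l : dual := functional (coord (vbasis {:M}) l).

(* The basis of M whose dual basis is vbasis {:dual}. *)
Definition predual_basis (a : 'I_(\dim {:dual})) : M :=
  \sum_l coord (vbasis {:dual}) a (dual_coord l) *: (vbasis {:M})`_l.

Lemma coord_dual a (f : dual) : coord (vbasis {:dual}) a f = f (predual_basis a).
Proof.
have {1}-> : f = \sum_(l < \dim {:M}) f (vbasis {:M})`_l *: dual_coord l.
  apply/lfunP => v; rewrite sum_lfunE {1}(coord_vbasis (memvf v)) linear_sum.
  apply: eq_bigr => l _; rewrite linearZ scale_lfunE functionalE /=.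
  by rewrite [LHS]mulrC.
rewrite !linear_sum; apply: eq_bigr => l _; rewrite !linearZ /=.
by rewrite [LHS]mulrC.
Qed.

(** Double duality: expand v in the basis of M, each coordinate form in the basis of the dual, and
    exchange the sums. *)
Lemma predual_basis_span v :
  v = \sum_(a < \dim {:dual}) (vbasis {:dual})`_a v *: predual_basis a.
Proof.
rewrite {1}(coord_vbasis (memvf v)); under [RHS]eq_bigr do rewrite scaler_sumr.
rewrite exchange_big; apply: eq_bigr => l _ /=.
under eq_bigr do rewrite scalerA; rewrite -scaler_suml; congr (_ *: _).
rewrite -[LHS](functionalE (coord (vbasis {:M}) l)) -/(dual_coord l).
rewrite {1}(coord_vbasis (memvf (dual_coord l))) sum_lfunE.
by apply: eq_bigr => a _; rewrite scale_lfunE [LHS]mulrC.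
Qed.

Variables (B : endo M) (Bd : endo dual) (c : k).
Hypothesis c0 : c != 0.
Hypothesis BdE : forall f v, endo_app Bd f v = c *: f (endo_app B v).

Let memB v : endo_app B v \in endo_img B.
Proof. exact/memv_img/memvf. Qed.

(** Through the predual basis the rows carry the same index set as the Pluecker coordinates on the
    dual. *)
Definition mixed_minor d (t : incr_seq dual d) (s : incr_seq M d) : k :=
  \det (\matrix_(i, l)
    coord (vbasis {:M}) (sval s l) (endo_app B (predual_basis (sval t i)))).

(** B factors through its image W as M -> W -> M, with inner dimension d, so each minor is a product
    of two determinants. The second factor gives the Pluecker coordinates of W; the first, up to a
    power of c, those of the image of the scaled transpose [Bd]. *)
Lemma image_minors d : \dim (endo_img B) = d ->
  let omega := @wedge k M d (fun i => (vbasis (endo_img B))`_i) in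
  exists alpha : ext_power dual d,
  [/\ forall t s, mixed_minor t s = alpha t * omega s,
      alpha != 0, omega != 0, \dim (endo_img Bd) = d
    & pluecker d (endo_img Bd) = <[alpha]>%VS].
Proof.
case: d /; set W := endo_img B => omega.
pose C := \matrix_(a, r) coord (vbasis W) r (endo_app B (predual_basis a)).
pose alpha : ext_power dual (\dim W) :=
  [ffun t : incr_seq dual (\dim W) => \det (\matrix_(i, r) C (sval t i) r)].
exists alpha.
have alpha0 : alpha != 0.
  have pre (r : 'I_(\dim W)) : exists v, endo_app B v == (vbasis W)`_r.
    have : (vbasis W)`_r \in W by rewrite vbasis_mem // mem_nth // size_tuple.
    by case/memv_imgP => v _ ->; exists v.
  (* Row r holds the coordinates, in the predual basis, of a preimage under B of the r-th basis
     vector of W; this makes C' a left inverse of C. *)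
  pose C' := \matrix_(r < \dim W, a < \dim {:dual})
    ((vbasis {:dual})`_a (xchoose (pre r)) : k).
  have C'C : C' *m C = 1%:M.
    apply/matrixP => r r'; rewrite !mxE.
    rewrite -(coord_free r r' (basis_free (vbasisP W))).
    rewrite -(eqP (xchooseP (pre r))) {1}(predual_basis_span (xchoose (pre r))).
    rewrite /endo_app !linear_sum; apply: eq_bigr => a _.
    by rewrite !mxE !linearZ.
  have [t t_incr t0] := incr_minor_neq0 C'C.
  apply: contraNneq t0 => /ffunP/(_ (exist _ t t_incr)).
  by rewrite !ffunE /= => ->.
have omega0 : omega != 0.
  pose w := \matrix_(l < \dim {:M}, r < \dim W) coord (vbasis {:M}) l (vbasis W)`_r.
  pose w' := \matrix_(r < \dim W, l < \dim {:M}) coord (vbasis W) r (vbasis {:M})`_l.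
  have w'w : w' *m w = 1%:M.
    apply/matrixP => r r'; rewrite !mxE eq_sym.
    rewrite -(coord_free r' r (basis_free (vbasisP W))).
    rewrite {1}(coord_vbasis (memvf (vbasis W)`_r')) linear_sum.
    by apply: eq_bigr => l _; rewrite !mxE linearZ mulrC.
  have [s s_incr s0] := incr_minor_neq0 w'w.
  apply: contraNneq s0 => /ffunP/(_ (exist _ s s_incr)).
  rewrite !ffunE /= => <-; rewrite -det_tr; apply/eqP; congr (\det _).
  by apply/matrixP => i l; rewrite !mxE.
(* The images under [Bd] of the coordinate forms of W; their dual coordinates are c times the
   columns of C. *)
pose chi (r : 'I_(\dim W)) := endo_app Bd (functional (coord (vbasis W) r)).
have chiE r v : chi r v = c * coord (vbasis W) r (endo_app B v).
  by rewrite /chi BdE functionalE.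
have chi_mem r : chi r \in endo_img Bd by exact/memv_img/memvf.
have wedge_chi : wedge chi = c ^+ \dim W *: alpha.
  apply/ffunP => t; rewrite !ffunE -[RHS]detZ -[LHS]det_tr; congr (\det _).
  by apply/matrixP => i l; rewrite !mxE coord_dual chiE.
have wedge_chi0 : wedge chi != 0.
  by rewrite wedge_chi scaler_eq0 negb_or alpha0 expf_neq0.
have dimBd : \dim (endo_img Bd) = \dim W.
  apply/eqP; rewrite eqn_leq (wedge_dim chi_mem wedge_chi0) andbT.
  suff /dimvS/leq_trans : (endo_img Bd <= <<[tuple chi r | r < \dim W]>>)%VS.
    by apply; rewrite (leq_trans (dim_span _)) ?size_tuple.
  apply/subvP => _ /memv_imgP[f _ ->].
  (* The composite of f with B depends only on the values of f on a basis of W. *)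
  have -> : Bd f = \sum_(r < \dim W) f (vbasis W)`_r *: chi r.
    apply/lfunP => v; rewrite sum_lfunE [LHS]BdE {1}(coord_vbasis (memB v)).
    rewrite linear_sum scaler_sumr; apply: eq_bigr => r _.
    by rewrite scale_lfunE chiE linearZ /= [RHS]mulrCA [_ *: f _]mulrC.
  apply: memv_suml => r _; apply/memvZ/memv_span.
  by apply/tnthP; exists r; rewrite tnth_mktuple.
split=> // [t s|].
  rewrite /mixed_minor (wedge_coord (U := W)) // det_mulmx !ffunE.
  by congr (\det _ * _); apply/matrixP => i l; rewrite !mxE.
rewrite (pluecker_wedge dimBd chi_mem) // wedge_chi vlineZ //.
by rewrite expf_neq0.
Qed.

End DualImage.

(** * Degrees of morphisms and generic operators *)

Section HomogeneousDet.
Variables (k : fieldType) (n j : nat).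

Lemma homog_prod_const (I : Type) (r : seq I) (F : I -> {mpoly k[n]}) :
  (forall i, F i \is j.-homog) -> \prod_(i <- r) F i \is (size r * j).-homog.
Proof.
move=> homF; elim: r => [|i r IH]; first by rewrite big_nil dhomog1.
by rewrite big_cons mulSn dhomogM.
Qed.

Lemma homog_det d (A : 'M[{mpoly k[n]}]_d) :
  (forall i l, A i l \is j.-homog) -> \det A \is (d * j).-homog.
Proof.
move=> homA; apply: rpred_sum => s _; rewrite rpredMsign.
have sz : size (index_enum 'I_d) = d.
  by rewrite [index_enum _]unlock -enumT size_enum_ord.
by have := @homog_prod_const _ (index_enum 'I_d) (fun i => A i (s i));
  rewrite sz; apply.
Qed.

End HomogeneousDet.

Section Points.
Variables (k : fieldType) (W : vectType k) (V : {vspace W}).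

Lemma nonzero_pt_coord (v : 'I_(\dim V) -> k) : nonzero_pt v ->
  exists x, [/\ x \in V, x != 0 & (fun l => coord (vbasis V) l x) =1 v].
Proof.
move=> [i vi]; pose x := \sum_l v l *: (vbasis V)`_l.
have xE l : coord (vbasis V) l x = v l.
  exact: (coord_sum_free _ _ (basis_free (vbasisP V))).
exists x; split=> //.
  by apply: memv_suml => l _; rewrite memvZ // vbasis_mem // mem_nth // size_tuple.
by apply: contraNneq vi => x0; rewrite -xE x0 linear0.
Qed.

End Points.

Section Degree.
Variables (k : closedFieldType) (W : vectType k) (V : {vspace W}).
Variables (I : finType) (U : pred {vspace W}).
Variable phi : {vspace W} -> {vspace coord_space k I}.
Hypothesis Utotal : forall x, x \in V -> x != 0 -> U <[x]>%VS.

(** A zero of a common divisor is a common zero of all [f i]. There is none off the origin, so the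
    divisor is a unit. *)
Lemma nonvanishing_has_degree (f : I -> {mpoly k[\dim V]}) d :
    (1 < \dim V)%N -> (forall i, f i \is d.-homog) ->
    (forall x, x \in V -> x != 0 ->
      let fx : coord_space k I :=
        [ffun i => (f i).@[fun l => coord (vbasis V) l x]] in
      fx != 0 /\ phi <[x]>%VS = <[fx]>%VS) ->
  morphism_has_degree V U phi d.
Proof.
move=> V2 homf fphi; exists f; split=> // [h hf|x xV x0 _]; last exact: fphi.
apply: nonvanishing_unit => // v /nonzero_pt_coord[x [xV x0 xv]].
have [fx0 _] := fphi x xV x0; apply: contraNneq fx0 => hv0.
apply/eqP/ffunP => i; rewrite !ffunE; have [q ->] := hf i.
by rewrite mevalM (meval_eq _ xv) hv0 mul0r.
Qed.

(** Two coordinate systems f and f' are proportional at every point, so they form a matrix with two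
    rows and rank one. It factors as v u; the entries of v divide f and f', hence are constants, and
    f, f' have the degree of u. *)
Lemma has_degree_uniq d d' : (0 < \dim V)%N ->
  morphism_has_degree V U phi d -> morphism_has_degree V U phi d' -> d = d'.
Proof.
move=> V0 [f [homf gcdf fphi]] [f' [homf' gcdf' fphi']].
have cross i l : f i * f' l = f l * f' i.
  apply: mpoly_eq_on_nonzero => // v /nonzero_pt_coord[x [xV x0 xv]].
  have [_ E] := fphi x xV x0 (Utotal xV x0).
  have [_ E'] := fphi' x xV x0 (Utotal xV x0).
  pose ev (h : I -> {mpoly k[\dim V]}) : coord_space k I :=
    [ffun s => (h s).@[fun l => coord (vbasis V) l x]].
  have /vlineP[a fxE] : ev f \in <[ev f']>%VS.
    have EE : <[ev f]>%VS = <[ev f']>%VS by rewrite -[LHS]E -[RHS]E'.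
    by rewrite -EE memv_line.
  have fE s : (f s).@[v] = a * (f' s).@[v].
    have := congr1 (fun g : coord_space k I => g s) fxE.
    by rewrite !ffunE !(meval_eq _ xv).
  by rewrite !mevalM !fE mulrAC.
pose C (b : bool) i := if b then f i else f' i.
have [b b' l l'|v [u CE]] :=
  rank_one_factor (@mpoly_gcd_domain k (\dim V)) (C := C).
  case: b; case: b'; rewrite /C; [exact: mulrC | exact: cross | | exact: mulrC].
  by rewrite mulrC cross mulrC.
have unit1 : v true \is a GRing.unit.
  by apply: gcdf => i; exists (u i); rewrite -(CE true).
have unit2 : v false \is a GRing.unit.
  by apply: gcdf' => i; exists (u i); rewrite -(CE false).
have const p : p \is a GRing.unit -> exists2 a : k, a != 0 & p = a%:MP_[\dim V].
  move=> /andP[/eqP pE]; rewrite unitfE => ?.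
  by exists (p@_0).
have [a a0 aE] := const _ unit1; have [b b0 bE] := const _ unit2.
(* Otherwise f = 0, and coprimality would make 0 a unit. *)
have [i ui] : exists i, u i != 0.
  apply: contrapT => none; have := unitr0 {mpoly k[\dim V]}.
  rewrite gcdf // => i; exists 0; rewrite mul0r -[f i]/(C true i) CE.
  have [->|ui] := eqVneq (u i) 0; first by rewrite mulr0.
  by case: none; exists i.
have fE : f i = a *: u i by rewrite -mul_mpolyC -aE -CE.
have fE' : f' i = b *: u i by rewrite -mul_mpolyC -bE -CE.
have := homf i; have := homf' i; rewrite fE fE' => hu' hu.
apply: (dhomog_uniq ui).
  by rewrite -[u i]scale1r -(mulVf a0) -scalerA; apply: dhomogZ hu.
by rewrite -[u i]scale1r -(mulVf b0) -scalerA; apply: dhomogZ hu'.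
Qed.

Lemma morphism_degreeE d : (0 < \dim V)%N ->
  morphism_has_degree V U phi d -> morphism_degree V U phi = d.
Proof.
move=> V0 hd; rewrite /morphism_degree; case: pselect => [ex|]; last first.
  by case; exists d.
by case: cid => d' hd' /=; apply: has_degree_uniq hd' hd.
Qed.

End Degree.

Section EndoPowers.
Variables (k : fieldType) (M : vectType k).
Implicit Type u : endo M.

Lemma endo_exprZ (a : k) u n : (a *: u) ^+ n = a ^+ n *: u ^+ n.
Proof.
elim: n => [|n IH]; first by rewrite !expr0 scale1r.
by rewrite !exprS IH -endo_scaleAl -endo_scaleAr scalerA.
Qed.

Lemma endo_imgZ (a : k) u : a != 0 -> endo_img (a *: u) = endo_img u.
Proof.
move=> a0; apply/vspaceP => v; apply/memv_imgP/memv_imgP => -[w _ ->].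
  by exists (a *: w); rewrite ?memvf // scale_lfunE linearZ.
exists (a^-1 *: w); rewrite ?memvf // scale_lfunE linearZ /=.
by rewrite scalerA divff // scale1r.
Qed.

Lemma endo_img0 : endo_img (0 : endo M) = 0%VS.
Proof.
apply/eqP; rewrite -subv0; apply/subvP => _ /memv_imgP[w _ ->].
by rewrite zero_lfunE mem0v.
Qed.

End EndoPowers.

(** [jimage] and [jrank_open] read a line through its [vpick]; this allows any other spanning vector
    to replace it up to a harmless scalar. *)
Lemma vpick_line (k : fieldType) (W : vectType k) (x : W) : x != 0 ->
  exists2 a : k, a != 0 & vpick <[x]>%VS = a *: x.
Proof.
move=> x0; have /vlineP[a aE] := memv_pick <[x]>%VS; exists a => //.
have : vpick <[x]>%VS != 0 by rewrite vpick0 -dimv_eq0 dim_vline x0.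
by apply: contraNneq => a0; rewrite aE a0 scale0r.
Qed.

Section JRank.
Variables (k : fieldType) (p : nat) (g : restrictedLie k p).
Variables (M : vectType k) (rho : renv_module g M) (j : nat).

Lemma opX_imgZ a x : a != 0 ->
  endo_img (op rho (a *: x) ^+ j) = endo_img (op rho x ^+ j).
Proof. by move=> a0; rewrite opZ endo_exprZ endo_imgZ // expf_neq0. Qed.

Lemma jimage_line x : x != 0 ->
  jimage rho j <[x]>%VS = endo_img (op rho x ^+ j).
Proof. by case/vpick_line => a a0 aE; rewrite /jimage aE opX_imgZ. Qed.

Lemma op_rank0 : (0 < j)%N -> op_rank rho j 0 = 0%N.
Proof.
move=> j0; rewrite /op_rank -(scale0r 0) opZ scale0r.
by case: j j0 => // i _; rewrite exprS mul0r endo_img0 dimv0.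
Qed.

Lemma op_rank_leq x : (op_rank rho j x < (\dim {:M}).+1)%N.
Proof. by rewrite ltnS dimvS ?subvf. Qed.

Lemma jrank_const x : (0 < j)%N -> constant_jrank rho j ->
  x \in nullcone g -> x != 0 -> jrank rho j = op_rank rho j x.
Proof.
move=> j0 cr xV x0; apply/eqP; rewrite eqn_leq; apply/andP; split.
  (* Constancy of rank says nothing about y = 0, which contributes rank 0 because j > 0. *)
  apply/bigmax_leqP => r /asboolP[y yV <-]; have [->|y0] := eqVneq y 0.
    by rewrite op_rank0.
  by rewrite (cr y x).
apply: (@leq_bigmax_cond _ _ (fun r : 'I_(\dim {:M}).+1 => nat_of_ord r)
  (Ordinal (op_rank_leq x))).
by apply/asboolP; exists x.
Qed.

Lemma jrank_trivial : (0 < j)%N -> (forall x, x \in nullcone g -> x = 0) ->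
  jrank rho j = 0%N.
Proof.
move=> j0 triv; apply/eqP; rewrite -leqn0; apply/bigmax_leqP => r.
by move=> /asboolP[y /triv-> <-]; rewrite op_rank0.
Qed.

(** The rank occurs in the type of the Pluecker coordinates. A free [d] gives M and its dual a
    common index, although their ranks are equal only by a proof. *)
Lemma jdegreeE d V : jrank rho j = d -> d != 0%N ->
  jdegree rho j V = morphism_degree V (jrank_open rho j V)
    (@pluecker k M d \o jimage rho j).
Proof. by move=> <-; rewrite /jdegree => /negPf ->. Qed.

End JRank.

Section GenericOperator.
Variables (k : fieldType) (p : nat) (g : restrictedLie k p).
Variables (M : vectType k) (rho : renv_module g M) (V : {vspace g}).
Local Notation n := (\dim V).
Local Notation N := (\dim {:M}).

(* Row r holds the coordinates of x.e_r, where x is the generic element of V. *)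
Definition generic_op : 'M[{mpoly k[n]}]_N :=
  \matrix_(r, l) \sum_(i < n)
    coord (vbasis {:M}) l (endo_app (op rho (vbasis V)`_i) (vbasis {:M})`_r)
      *: 'X_i.

Fixpoint generic_opX (j : nat) (m : M) : 'rV[{mpoly k[n]}]_N :=
  if j is j'.+1 then generic_opX j' m *m generic_op
  else \row_l (coord (vbasis {:M}) l m)%:MP.

Lemma generic_opX_homog j m l : generic_opX j m 0 l \is j.-homog.
Proof.
elim: j l => [|j IH] l /=.
  by rewrite mxE -[_%:MP]mulr1 mul_mpolyC dhomogZ ?dhomog1.
rewrite mxE; apply: rpred_sum => r _; rewrite -(addn1 j) dhomogM // mxE.
by apply: rpred_sum => i _; rewrite dhomogZ // dhomogX; apply/eqP/mdeg1.
Qed.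

Lemma generic_opX_eval j m l x : x \in V ->
  (generic_opX j m 0 l).@[fun i => coord (vbasis V) i x] =
  coord (vbasis {:M}) l (endo_app (op rho x ^+ j) m).
Proof.
move=> xV; elim: j l => [|j IH] l /=.
  by rewrite mxE mevalC expr0 endo_app1.
rewrite mxE rmorph_sum exprS endo_appM.
rewrite [endo_app (_ ^+ _) m](coord_vbasis (memvf _)).
rewrite {1}/endo_app !linear_sum; apply: eq_bigr => r _.
rewrite [LHS]mevalM IH !linearZ /=; congr (_ * _).
rewrite mxE rmorph_sum /= {2}(coord_vbasis xV).
have opS (s : seq 'I_n) (F : 'I_n -> g) :
    op rho (\sum_(i <- s) F i) = \sum_(i <- s) op rho (F i).
  apply: (big_morph (op rho) (opD rho)).
  by rewrite -(scale0r 0) opZ scale0r.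
rewrite opS sum_lfunE linear_sum; apply: eq_bigr => i _.
by rewrite mevalZ mevalXU opZ scale_lfunE linearZ mulrC.
Qed.

End GenericOperator.

Lemma coord_space_neq0 (k : fieldType) (I : finType) (z : coord_space k I) :
  z != 0 -> exists i, z i != 0 :> k.
Proof.
move=> z0; apply: contrapT => none; case/eqP: z0; apply/ffunP => i.
by rewrite ffunE; apply/eqP; apply: contra_notT none => ?; exists i.
Qed.

(** A nonzero matrix of rank one determines its column and its row up to scalars, read off at an
    entry where both [alpha] and [omega] are nonzero. *)
Lemma rank_one_line (k : fieldType) (I J : finType) (alpha v : coord_space k I)
    (omega u : coord_space k J) :
    (forall i l, v i * u l = alpha i * omega l) -> alpha != 0 -> omega != 0 ->
  [/\ v != 0, u != 0, <[v]>%VS = <[alpha]>%VS & <[u]>%VS = <[omega]>%VS].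
Proof.
move=> E a0 o0.
have [i ai] := coord_space_neq0 a0; have [l ol] := coord_space_neq0 o0.
have : v i * u l != 0 by rewrite E mulf_neq0.
rewrite mulf_eq0 negb_or => /andP[vi ul].
have c1 : (omega l : k) / (u l : k) != 0 by rewrite mulf_neq0 ?invr_eq0.
have c2 : (alpha i : k) / (v i : k) != 0 by rewrite mulf_neq0 ?invr_eq0.
have vE : v = ((omega l : k) / (u l : k)) *: alpha.
  apply/ffunP => s; rewrite [RHS]ffunE; apply: (mulIf ul).
  rewrite E [RHS](_ : _ = (omega l : k) / (u l : k) * alpha s * u l) //.
  by rewrite mulrAC divfK // mulrC.
have uE : u = ((alpha i : k) / (v i : k)) *: omega.
  apply/ffunP => s; rewrite [RHS]ffunE; apply: (mulfI vi).
  rewrite E [RHS](_ : _ = v i * ((alpha i : k) / (v i : k) * omega s)) //.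
  by rewrite mulrA [v i * _]mulrC divfK.
split.
- by rewrite vE scaler_eq0 negb_or c1.
- by rewrite uE scaler_eq0 negb_or c2.
- by rewrite vE vlineZ.
- by rewrite uE vlineZ.
Qed.

(** * Minors of the generic j-th power on a module and its dual *)

Section DualPowers.
Variables (k : closedFieldType) (p : nat) (char_p : p \in [pchar k]).
Variables (g : restrictedLie k p) (M : vectType k) (rho : renv_module g M).
Variable j : nat.
Local Notation dual := (dual_space M).
Local Notation rho' := (dual_module char_p rho).

Lemma op_dualX x (f : dual) v :
  endo_app (op rho' x ^+ j) f v = (-1) ^+ j *: f (endo_app (op rho x ^+ j) v).
Proof. by rewrite lift_moduleE dual_opX. Qed.

Let sign_neq0 : (-1) ^+ j != 0 :> k. Proof. by rewrite signr_eq0. Qed.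

Lemma op_image_minors d x : op_rank rho j x = d ->
  let omega := @wedge k M d (fun i => (vbasis (endo_img (op rho x ^+ j)))`_i) in
  exists alpha : ext_power dual d,
  [/\ forall t s, mixed_minor (op rho x ^+ j) t s = alpha t * omega s,
      alpha != 0, omega != 0, op_rank rho' j x = d
    & pluecker d (endo_img (op rho' x ^+ j)) = <[alpha]>%VS].
Proof. exact: image_minors sign_neq0 (op_dualX x) d. Qed.

Lemma op_rank_dual x : op_rank rho' j x = op_rank rho j x.
Proof. by have [? []] := op_image_minors (erefl (op_rank rho j x)). Qed.

Lemma constant_jrank_dual : constant_jrank rho j -> constant_jrank rho' j.
Proof. by move=> cr x y xV yV x0 y0; rewrite !op_rank_dual; apply: cr. Qed.

Variables (V : {vspace g}) (d : nat).

Definition generic_minor (t : incr_seq dual d) (s : incr_seq M d) :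
    {mpoly k[\dim V]} :=
  \det (\matrix_(i, l)
    generic_opX rho V j (predual_basis (sval t i)) 0 (sval s l)).

Lemma generic_minor_homog t s : generic_minor t s \is (d * j).-homog.
Proof. by apply: homog_det => i l; rewrite mxE generic_opX_homog. Qed.

Lemma generic_minor_eval t s x : x \in V ->
  (generic_minor t s).@[fun l => coord (vbasis V) l x]
    = mixed_minor (op rho x ^+ j) t s.
Proof.
move=> xV; rewrite /generic_minor -det_map_mx /mixed_minor; congr (\det _).
by apply/matrixP => i l; rewrite !mxE; apply: generic_opX_eval.
Qed.

Hypothesis V_gt1 : (1 < \dim V)%N.
Hypothesis rankV : forall x, x \in V -> x != 0 -> op_rank rho j x = d.

Let V_gt0 : (0 < \dim V)%N. Proof. exact: ltn_trans V_gt1. Qed.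

(** It suffices to compare values off the origin, where constant rank d makes every minor a product
    [alpha t * omega s]. *)
Lemma generic_minor_rank1 t t' s s' :
  generic_minor t s * generic_minor t' s' = generic_minor t s' * generic_minor t' s.
Proof.
apply: (mpoly_eq_on_nonzero V_gt0) => v /nonzero_pt_coord[x [xV x0 xv]].
have [alpha [E _ _ _ _]] := op_image_minors (rankV xV x0).
by rewrite !mevalM -!(meval_eq _ xv) !generic_minor_eval // !E mulrACA
  [X in _ * X]mulrC mulrACA.
Qed.

(** The open sets are arbitrary because the homogeneous coordinates found here are valid at every
    nonzero point of V. *)
Lemma jrank_degrees (U U' : pred {vspace g}) :
  exists m m', [/\ (m + m' = d * j)%N,
    morphism_has_degree V U (@pluecker k M d \o jimage rho j) m &
    morphism_has_degree V U' (@pluecker k dual d \o jimage rho' j) m'].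
Proof.
have x0n0 : vpick V != 0 by rewrite vpick0 -dimv_eq0 -lt0n.
have [t0 [s0 C0]] : exists t s, generic_minor t s != 0.
  have [alpha [E a0 o0 _ _]] := op_image_minors (rankV (memv_pick V) x0n0).
  have [t at0] := coord_space_neq0 a0; have [s os0] := coord_space_neq0 o0.
  exists t, s; apply: contraNneq (mulf_neq0 at0 os0) => C0.
  by rewrite -E -generic_minor_eval ?memv_pick // C0 meval0.
have [m [m' [v [u [mm' homv homu CE]]]]] :=
  homog_rank_one_factor C0 generic_minor_homog generic_minor_rank1.
pose ev (K : finType) (h : K -> {mpoly k[\dim V]}) (x : g) : coord_space k K :=
  [ffun s => (h s).@[fun l => coord (vbasis V) l x]].
have ev_line x : x \in V -> x != 0 ->
  [/\ ev _ v x != 0, ev _ u x != 0,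
      <[ev _ v x]>%VS = pluecker d (endo_img (op rho' x ^+ j)) &
      <[ev _ u x]>%VS = pluecker d (endo_img (op rho x ^+ j))].
  move=> xV xn0; have [alpha [E a0 o0 _ ->]] := op_image_minors (rankV xV xn0).
  apply: rank_one_line => // t s; rewrite -E -generic_minor_eval // CE mevalM.
  by rewrite !ffunE.
(* The column factor [v], of degree m, describes the dual, and the row factor [u], of degree m',
   describes M. *)
exists m', m; split; first by rewrite addnC.
  apply: nonvanishing_has_degree homu _ => // x xV xn0 /=.
  by have [_ u0 _ uE] := ev_line x xV xn0; rewrite jimage_line // -uE.
apply: nonvanishing_has_degree homv _ => // x xV xn0 /=.
by have [v0 _ vE _] := ev_line x xV xn0; rewrite jimage_line // -vE.
Qed.

End DualPowers.

Lemma jrank_open_line (k : fieldType) (p : nat) (g : restrictedLie k p)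
    (M : vectType k) (rho : renv_module g M) j (V : {vspace g}) x :
  x \in V -> x != 0 -> op_rank rho j x = jrank rho j ->
  jrank_open rho j V <[x]>%VS.
Proof.
move=> xV x0 rk; rewrite /jrank_open -memvE xV dim_vline x0 /=.
have [a a0 ->] := vpick_line x0.
by rewrite /op_rank opX_imgZ // -/(op_rank rho j x) rk.
Qed.

Local Close Scope ring_scope.

(** If dim V = 1, the projective space is a point, coprime coordinates on it are constants and both
    degrees are 0, while j rk^j(M) can be positive; hence [dimV]. *)
Theorem theoremA (k : closedFieldType) (p : nat) (char_p : p \in [pchar k]%R)
    (g : restrictedLie k p)
    (V : {vspace g}) (nullcone_subspace : V =i nullcone g)
    (dimV : (\dim V != 1)%N)
    (j : nat) (j_gt0 : (0 < j)%N) (j_ltp : (j < p)%N)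
    (M : vectType k) (rho : renv_module g M)
    (const_rank : constant_jrank rho j) :
  (jdegree rho j V + jdegree (dual_module char_p rho) j V
    = j * jrank rho j)%N.
Proof.
set rho' := dual_module char_p rho.
have const_rank' : constant_jrank rho' j by apply: constant_jrank_dual.
(* For V = 0 only x = 0 enters the maximum in [jrank], so both ranks and both degrees vanish. *)
have [V0|V_neq0] := eqVneq V 0%VS.
  have triv x : x \in nullcone g -> x = 0%R.
    by rewrite -nullcone_subspace V0 memv0 => /eqP.
  by rewrite /jdegree !jrank_trivial // muln0.
have V_gt0 : (0 < \dim V)%N by rewrite lt0n dimv_eq0.
have V_gt1 : (1 < \dim V)%N by rewrite ltn_neqAle eq_sym dimV.
have x0V := memv_pick V; have x0n0 : vpick V != 0%R by rewrite vpick0.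
have rk x : x \in V -> x != 0%R -> op_rank rho j x = jrank rho j.
  by move=> xV xn0; rewrite (jrank_const _ _ _ xn0) // -nullcone_subspace.
have rk' x : x \in V -> x != 0%R -> op_rank rho' j x = jrank rho' j.
  by move=> xV xn0; rewrite (jrank_const _ _ _ xn0) // -nullcone_subspace.
have rkE : jrank rho' j = jrank rho j.
  by rewrite -(rk' _ x0V x0n0) op_rank_dual rk.
have [d0|dn0] := eqVneq (jrank rho j) 0%N; first by rewrite /jdegree rkE d0 muln0.
have [m [m' [mm' hm hm']]] := jrank_degrees char_p V_gt1 rk
  (jrank_open rho j V) (jrank_open rho' j V).
rewrite (jdegreeE V erefl dn0) (jdegreeE V rkE dn0).
rewrite (morphism_degreeE _ V_gt0 hm) => [|x xV xn0]; last first.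
  by apply: jrank_open_line => //; apply: rk.
rewrite (morphism_degreeE _ V_gt0 hm') => [|x xV xn0]; last first.
  by apply: jrank_open_line => //; apply: rk'.
by rewrite mm' mulnC.
Qed.
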